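(* Let $n$ be sufficiently large. For every integer $L = O(\log n)$ and every sufficiently small $\epsilon = \Omega(1/n)$ (i.e. $c/n \le \epsilon \le c_0$ for suitable constants $c, c_0>0$), there exist a parameter $\beta = \beta(L,\epsilon) \ge 1$ and two distributions $\mathcal{H}^+$ and $\mathcal{H}^-$ over histograms of sample sets on $[n]$, each sample set containing at least $s = \Omega\left(n^{1-1/L}\log^2(1/\epsilon)/L\right)$ samples, with the following properties: (1) a histogram drawn from $\mathcal{H}^+$ is a histogram of i.i.d. samples drawn from a (random) distribution on $[n]$ that is $\frac{1}{\beta n}$-big; (2) a histogram drawn from $\mathcal{H}^-$ is a histogram of i.i.d. samples drawn from a (random) distribution on $[n]$ that is $\epsilon$-far (in total variation distance) from every $\frac{1}{\beta n}$-big distribution; (3) $d_{TV}(\mathcal{H}^+,\mathcal{H}^-) \le 0.01$; (4) every probability distribution from which these histograms are drawn (in either (1) or (2)) assigns probability at most $p_{\max} = O\left(L^2/(n\log^2(1/\epsilon))\right)$ to every element of $[n]$.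
   Context: A probability distribution $p$ on $[n]=\{1,\dots,n\}$ is $T$-big if $p(i)\ge T$ for every $i\in[n]$. Let $\mathrm{Big}(n,T)$ be the set of $T$-big distributions on $[n]$; $p$ is $\epsilon$-far from $T$-big if $\min_{q\in \mathrm{Big}(n,T)} d_{TV}(p,q)\ge \epsilon$, where $d_{TV}$ is total variation distance. The histogram of a multiset of samples from a distribution on $[n]$ is the vector $h=(h_1,\dots,h_n)$ where $h_i$ is the number of occurrences of element $i$ in the sample set. $\mathcal{H}^+$ and $\mathcal{H}^-$ are mixtures: a random distribution is first chosen, and then a histogram of samples from it is produced.
   Formalization: In (4), p_max is O(max(1/n, L^2/(n log^2(1/ε)))): the stated bound fails e.g. for L = 1, ε = c/n, where it drops below 1/n although every distribution on [n] has an element of mass at least 1/n; it agrees with the stated order whenever L = Ω(log(1/ε)). *)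

(* Defs.v *)
From HB Require Import structures.
From mathcomp Require Export all_boot all_order all_algebra.
From mathcomp Require Export all_classical all_reals all_analysis.

Set Implicit Arguments.
Unset Strict Implicit.
Unset Printing Implicit Defensive.

Import Order.TTheory GRing.Theory Num.Theory.
Import numFieldNormedType.Exports.

Local Open Scope classical_set_scope.
Local Open Scope ring_scope.

Section Distributions.
Variable R : realType.

(* Discrete distributions are given by their mass functions. The esum makes
   one definition serve both [n] (finite) and histograms (countable). *)
Definition tv_dist (T : choiceType) (f g : T -> R) : \bar R :=
  ((2^-1)%:E * \esum_(x in [set: T]) `|f x - g x|%:E)%E.

Definition is_distr (n : nat) (p : 'I_n -> R) : Prop :=
  (forall i, 0 <= p i) /\ \sum_(i < n) p i = 1.

Definition Big (n : nat) (T : R) : set ('I_n -> R) :=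
  [set q | is_distr q /\ forall i, T <= q i].

Definition far_from_big (n : nat) (T eps : R) (p : 'I_n -> R) : Prop :=
  forall q, Big T q -> (eps%:E <= tv_dist p q)%E.

(* Every distribution on [n] gives mass at least 1/n to some element, so any
   uniform upper bound on the masses is at least 1/n. *)
Lemma distr_bound_ge (n : nat) (p : 'I_n -> R) (M : R) :
  is_distr p -> (forall i, p i <= M) -> n%:R^-1 <= M.
Proof.
case: n p => [|n] p [_ p1] pM.
  by move: p1; rewrite big_ord0 => /esym/eqP; rewrite oner_eq0.
have sumM : \sum_(i < n.+1) p i <= \sum_(i < n.+1) M by apply: ler_sum.
move: sumM; rewrite p1 sumr_const card_ord => sumM.
by rewrite -[leLHS]mul1r ler_pdivrMr ?ltr0n // mulr_natr.
Qed.

End Distributions.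

Definition histogram (n : nat) (x : seq 'I_n) : {ffun 'I_n -> nat} :=
  [ffun i => count_mem i x].

(* Law of the histogram of N i.i.d. samples from p. *)
Definition iid_hist_law (R : realType) (n N : nat) (p : 'I_n -> R)
    (h : {ffun 'I_n -> nat}) : R :=
  \sum_(x : N.-tuple 'I_n | histogram x == h) \prod_(j < N) p (tnth x j).

(* A distribution over histograms that arises as a mixture: a distribution and
   a sample size are drawn at random (possibly jointly), then that many i.i.d.
   samples are taken from that distribution. *)
Record hist_mixture (R : realType) (n : nat) := HistMixture {
  mix_display : measure_display;
  mix_space : measurableType mix_display;
  mix_prob : probability mix_space R;
  mix_distr : mix_space -> 'I_n -> R;
  mix_size : mix_space -> nat;
  mix_distr_meas : forall i, measurable_fun setT (fun w => mix_distr w i);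
  mix_size_meas : measurable_fun setT mix_size;
  mix_distrP : forall w, is_distr (mix_distr w) }.

Definition mix_law (R : realType) (n : nat) (H : hist_mixture R n)
    (h : {ffun 'I_n -> nat}) : R :=
  \int[mix_prob H]_w iid_hist_law (mix_size w) (mix_distr w) h.

(* Main.v *)
Require Import Defs.
From mathcomp Require Import ring lra zify.

Import Order.TTheory GRing.Theory Num.Theory.
Import numFieldNormedType.Exports.

Set Implicit Arguments.
Unset Strict Implicit.
Unset Printing Implicit Defensive.

Local Open Scope classical_set_scope.
Local Open Scope ring_scope.

(** Two probability vectors P+ and P- on finitely many atoms in {0} U [a, b] are
    built with equal moments of order < d; P+ does not charge 0, P- charges it
    with mass about exp (- v d), both have mean O(a), and b / a = O(1 / v^2).
    They are the two parts of a signed measure supported on 0, a and shifted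
    Chebyshev extremal points; evaluating the Chebyshev polynomial T_d outside
    [-1, 1] gives the mass at 0.

    Drawing n i.i.d. atoms u_i, a Poisson number of samples of mean sum_i u_i,
    and the samples from u / sum_i u_i makes the counts independent mixed Poisson
    variables, whose laws under P+ and P- are close because d moments agree.
    Conditioning on a likely event (sum of the u_i, number of zero atoms, sample
    size) costs little in total variation and makes the required properties hold
    surely.

    With l = ln (1 / eps), one takes d = max (L, floor l + 1) and v = l / (2 d).
    Replacing L by a larger d is harmless since n^(1 - 1/d) / d is nondecreasing
    for d <= ln n. The parameter beta is a constant. *)

(** * Chebyshev nodes *)

Section Chebyshev.
Variable R : realType.
Implicit Types (d k i j : nat) (x t u : R).

(** With [j] ranging over [2 * d] values the angles fill the circle: inner extremal points of T_d
    are met twice, the endpoints 1 and -1 once. *)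
Definition cheb_angle d j : R := pi * j%:R / d%:R.

(** Since 2 cos (x/2) cos (j x) = cos (j x + x/2) + cos (j x - x/2), the alternating sum
    telescopes. *)
Lemma telescope_alt_cos x (m : nat) :
  2 * cos (x / 2) * (\sum_(j < m) (-1) ^+ j * cos (j%:R * x)) =
  cos (x / 2) - (-1) ^+ m * cos (m%:R * x - x / 2).
Proof.
elim: m => [|m IH]; first by rewrite big_ord0 mul0r sub0r cosN expr0 mul1r subrr mulr0.
rewrite big_ord_recr /= mulrDr IH.
have -> : m.+1%:R * x - x / 2 = m%:R * x + x / 2 by rewrite -natr1; field.
rewrite exprS cosB cosD; ring.
Qed.

Lemma sum_alt_cos d k : (k < d)%N ->
  \sum_(j < d.*2) (-1) ^+ j * cos (k%:R * cheb_angle d j) = 0.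
Proof.
move=> kd; have d0 : d%:R != 0 :> R by rewrite pnatr_eq0; lia.
pose x : R := pi * k%:R / d%:R.
have angleE j : k%:R * cheb_angle d j = j%:R * x by rewrite /cheb_angle /x; field.
under eq_bigr do rewrite angleE.
(* Here [k < d] puts x / 2 in [0, pi / 2), so the telescoped identity can be divided by this
   cosine. *)
have cx : cos (x / 2) != 0.
  rewrite gt_eqF// cos_gt0_pihalf//.
  have x0 : 0 <= x by rewrite /x divr_ge0// mulr_ge0// pi_ge0.
  have xpi : x < pi.
    rewrite /x ltr_pdivrMr ?ltr0n; last lia.
    by rewrite ltr_pM2l ?pi_gt0// ltr_nat.
  by apply/andP; split; have := pi_gt0 R; lra.
apply: (mulfI (mulf_neq0 (@lt0r_neq0 _ 2 ltac:(lra)) cx)).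
rewrite mulr0 telescope_alt_cos -mul2n exprM sqrrN expr1n expr1n mul1r.
have -> : (2 * d)%:R * x - x / 2 = - (x / 2) + pi *+ 2 *+ k.
  by rewrite /x -[_ *+ k]mulr_natl -[pi *+ 2]mulr_natl natrM; field.
by rewrite (periodicn (@cosD2pi R)) cosN subrr.
Qed.

(** By cos t cos ((k+1) t) = (cos ((k+2) t) + cos (k t)) / 2, a power of the cosine is traded for at
    most one unit of frequency, which preserves the bound on [i + k]. *)
Lemma sum_alt_cosX d i k : (i + k < d)%N ->
  \sum_(j < d.*2) (-1) ^+ j * (cos (cheb_angle d j) ^+ i * cos (k%:R * cheb_angle d j)) = 0.
Proof.
elim: i k => [|i IH] k ikd.
  by under eq_bigr do rewrite expr0 mul1r; apply: sum_alt_cos.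
case: k ikd => [|k] ikd.
  rewrite -[RHS](IH 1%N); last lia.
  by apply: eq_bigr => j _; rewrite mul0r cos0 mul1r exprSr mulr1.
have h := congr2 +%R (IH k.+2 ltac:(lia)) (IH k ltac:(lia)).
rewrite /= addr0 -big_split in h.
rewrite -[RHS](mulr0 (2^-1)) -[in RHS]h mulr_sumr.
apply: eq_bigr => j _ /=; set t := cheb_angle d j.
have -> : k.+2%:R * t = k.+1%:R * t + t by rewrite -(natr1 k.+1); ring.
have -> : k%:R * t = k.+1%:R * t - t by rewrite -(natr1 k); ring.
by rewrite cosD cosB exprSr; field.
Qed.

Lemma sum_alt_poly d (q : {poly R}) : (size q <= d)%N ->
  \sum_(j < d.*2) (-1) ^+ j * q.[cos (cheb_angle d j)] = 0.
Proof.
move=> sq; under eq_bigr do rewrite horner_coef mulr_sumr.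
rewrite exchange_big big1// => i _.
have : (i + 0 < d)%N by have := ltn_ord i; lia.
move=> /sum_alt_cosX/(congr1 (fun z => q`_i * z)); rewrite mulr0 => h; rewrite -[RHS]h.
rewrite mulr_sumr; apply: eq_bigr => j _.
by rewrite mul0r cos0; ring.
Qed.

(** The pair (T_d, T_{d+1}), which makes the two-term recurrence structural. *)
Fixpoint chebT d : {poly R} * {poly R} :=
  if d is d'.+1 then let: (p, q) := chebT d' in (q, (2%:P * 'X) * q - p)
  else (1, 'X).

Lemma chebTS d : (chebT d.+1).1 = (chebT d).2.
Proof. by rewrite /=; case: (chebT d). Qed.

Lemma chebTSS d : (chebT d.+1).2 = (2%:P * 'X) * (chebT d).2 - (chebT d).1.
Proof. by rewrite /=; case: (chebT d). Qed.

Lemma size_chebT d : (size (chebT d).1 <= d.+1)%N /\ (size (chebT d).2 <= d.+2)%N.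
Proof.
elim: d => [|d [h1 h2]]; first by rewrite /= size_poly1 size_polyX.
rewrite chebTS chebTSS; split=> //.
rewrite (leq_trans (size_polyD _ _))// geq_max size_polyN (leq_trans h1) ?andbT; last lia.
rewrite (leq_trans (size_polyMleq _ _))//.
have : (size ((2%:P * 'X)%R : {poly R}) <= 2)%N.
  by rewrite size_mulX ?size_polyC ?polyC_eq0 ?pnatr_eq0.
lia.
Qed.

Lemma chebT_cos d x :
  (chebT d).1.[cos x] = cos (d%:R * x) /\ (chebT d).2.[cos x] = cos (d.+1%:R * x).
Proof.
elim: d => [|d [h1 h2]]; first by rewrite /= !hornerE ?mul0r cos0 ?mul1r.
rewrite chebTS chebTSS h2; split=> //.
rewrite !hornerE h1 h2.
have -> : d.+2%:R * x = d.+1%:R * x + x by rewrite -(natr1 d.+1); ring.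
have -> : d%:R * x = d.+1%:R * x - x by rewrite -(natr1 d); ring.
rewrite cosB cosD; ring.
Qed.

(** The analogue of T_d (cos x) = cos (d x) outside [-1, 1]: for u = e^z it reads T_d (cosh z) =
    cosh (d z). *)
Lemma chebT_hyp d u : u != 0 ->
  (chebT d).1.[(u + u^-1) / 2] = (u ^+ d + u^-1 ^+ d) / 2 /\
  (chebT d).2.[(u + u^-1) / 2] = (u ^+ d.+1 + u^-1 ^+ d.+1) / 2.
Proof.
move=> u0; elim: d => [|d [h1 h2]].
  by rewrite /= !hornerE !expr0 !expr1; split=> //; field.
rewrite chebTS chebTSS h2; split=> //.
rewrite !hornerE h1 h2 !exprS; move: (u ^+ d) (u^-1 ^+ d) => p r /=; field.
by rewrite u0.
Qed.

Lemma chebT_node d j : (0 < d)%N -> (chebT d).1.[cos (cheb_angle d j)] = (-1) ^+ j.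
Proof.
move=> d0; rewrite (chebT_cos d _).1.
have -> : d%:R * cheb_angle d j = pi *+ j.
  by rewrite /cheb_angle -mulr_natl; field; rewrite pnatr_eq0; lia.
elim: j => [|j IH]; first by rewrite mulr0n cos0.
by rewrite mulrSr cosDpi IH exprS mulN1r.
Qed.

(* Testing the annihilator of degree < d against (T_d(t) - T_d(x)) / (t - x). *)
Lemma sum_alt_inv d t : (0 < d)%N -> 1 < t ->
  (chebT d).1.[t] * (\sum_(j < d.*2) (-1) ^+ j / (t - cos (cheb_angle d j))) =
  \sum_(j < d.*2) (t - cos (cheb_angle d j))^-1.
Proof.
move=> d0 t1; set T := (chebT d).1.
have [q qE] : exists q, T - T.[t]%:P = q * ('X - t%:P).
  by apply/factor_theorem; rewrite /root !hornerE subrr.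
have sq : (size (q : {poly R}) <= d)%N.
  have [->|qn0] := eqVneq q 0; first by rewrite size_poly0.
  have : (size (q * ('X - t%:P) : {poly R})%R <= d.+1)%N.
    rewrite -qE (leq_trans (size_polyD _ _))// geq_max size_polyN.
    by rewrite (size_chebT d).1 (leq_trans (size_polyC_leq1 _)).
  rewrite size_Mmonic ?monicXsubC// size_XsubC; lia.
have tj j : t - cos (cheb_angle d j) != 0.
  by rewrite gt_eqF// subr_gt0 (le_lt_trans (cos_le1 _)).
apply/eqP; rewrite -subr_eq0 mulr_sumr -sumrB; apply/eqP.
rewrite -[RHS](sum_alt_poly sq).
apply: eq_bigr => j _; set c := cos _.
have : (T - T.[t]%:P).[c] = q.[c] * (c - t) by rewrite qE !hornerE.
rewrite !hornerE [T.[c]]chebT_node// => /(congr1 (fun z => z * ((-1) ^+ j / (c - t)))).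
have ct : c - t != 0 by rewrite -opprB oppr_eq0 tj.
have -> : q.[c] * (c - t) * ((-1) ^+ j / (c - t)) = (-1) ^+ j * q.[c] by field.
move=> <-.
have s2 : (-1) ^+ j * (-1) ^+ j = 1 :> R by rewrite -expr2 sqrr_sign.
transitivity ((T.[t] * (-1) ^+ j - (-1) ^+ j * (-1) ^+ j) / (t - c)).
  by rewrite s2 /=; field; rewrite tj.
by field; rewrite ct tj.
Qed.

End Chebyshev.

(** * Moment matching *)

Definition is_pmf (R : realType) (J : finType) (P : J -> R) :=
  (forall j, 0 <= P j) /\ \sum_j P j = 1.

Lemma sum_option (R : realType) (T : finType) (F : option T -> R) :
  \sum_j F j = F None + \sum_j F (Some j).
Proof.
rewrite (bigD1 None)//=; congr (_ + _).
rewrite (reindex_omap Some id)//=; last by case.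
by apply: eq_bigl => j; rewrite eqxx.
Qed.

(* The atoms are 0, a and the points t - cos (pi j / d); the signed weights are
   those of the divided differences f[0, a, y_j] summed with alternating signs.
   The extra node a makes the weights decay fast enough for the mean to stay of
   order a. *)
Section MomentMatching.
Variables (R : realType) (d : nat) (v rho : R).
Hypotheses (d_gt0 : (0 < d)%N) (v_gt0 : 0 < v) (v_le1 : v <= 1).
Hypotheses (rho_gt0 : 0 < rho) (rho_le : rho <= 8^-1).

(** [t] exceeds 1 by a quantity of order v^2 and [a] is half this excess, so y_j >= 2 a and y_j - a
    >= y_j / 2 at every node. *)
Let u : R := 1 + v.
Let t : R := (u + u^-1) / 2.
Let a : R := (t - 1) / 2.
Let y (j : 'I_d.*2) : R := t - cos (cheb_angle R d j).
Let Y : R := \sum_j (y j)^-1.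
Let T : R := (chebT R d).1.[t].

Let J : finType := option (option 'I_d.*2).
Let x (j : J) : R :=
  if j is Some j' then if j' is Some i then y i else a else 0.
(** The divided differences carry the factor a rho / Y: the total mass is then of order rho and the
    mass at 0 is rho / T. *)
Let om (j : J) : R :=
  if j is Some j' then
    if j' is Some i then rho / Y * (a * ((-1) ^+ i / (y i * (y i - a))))
    else - (rho / Y * \sum_(i < d.*2) (-1) ^+ i / (y i - a))
  else rho / Y * \sum_(i < d.*2) (-1) ^+ i / y i.

Let u_gt0 : 0 < u. Proof. by rewrite /u; move: v_gt0; lra. Qed.

Let tE : t - 1 = v ^+ 2 / (2 * u).
Proof. by rewrite /t /u; field; rewrite gt_eqF//; move: v_gt0; lra. Qed.

Let a_ge : v ^+ 2 / 8 <= a.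
Proof.
rewrite /a tE -mulrA ler_wpM2l ?sqr_ge0//.
rewrite -invfM lef_pV2 ?posrE ?mulr_gt0 ?u_gt0//.
by rewrite /u; move: v_le1; lra.
Qed.

Let a_gt0 : 0 < a.
Proof. by apply: lt_le_trans a_ge; rewrite divr_gt0 ?exprn_gt0. Qed.

Let t_le2 : t <= 2.
Proof.
have : v ^+ 2 / (2 * u) <= 1.
  rewrite ler_pdivrMr ?mulr_gt0// /u; move: v_gt0 v_le1; nra.
by rewrite -tE; lra.
Qed.

Let y_ge j : 2 * a <= y j.
Proof. by rewrite /y /a; have := cos_le1 (cheb_angle R d j); lra. Qed.

Let y_le j : y j <= 3.
Proof. by rewrite /y; have := cos_geN1 (cheb_angle R d j); move: t_le2; lra. Qed.

Let y_gt0 j : 0 < y j.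
Proof. by have := y_ge j; move: a_gt0; lra. Qed.

Let ya_gt0 j : 0 < y j - a.
Proof. by have := y_ge j; move: a_gt0; lra. Qed.

Let Y_gt0 : 0 < Y.
Proof.
have d2 : (0 < d.*2)%N by rewrite double_gt0.
rewrite /Y (bigD1 (Ordinal d2))//= ltr_pwDl ?invr_gt0 ?y_gt0//.
by apply: sumr_ge0 => j _; rewrite invr_ge0 ltW// y_gt0.
Qed.

Let T_val : T = (u ^+ d + u^-1 ^+ d) / 2.
Proof. by rewrite /T /t (chebT_hyp d (lt0r_neq0 u_gt0)).1. Qed.

Let T_ge1 : 1 <= T.
Proof.
rewrite T_val exprVn; have : 0 < u ^+ d by rewrite exprn_gt0// u_gt0.
move: (u ^+ d) => p p0; have : p * p^-1 = 1 by rewrite mulfV ?gt_eqF.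
have : 0 < p^-1 by rewrite invr_gt0.
move: (p^-1) => r r0 pr.
have := mulr_ge0 (sqr_ge0 (p - 1)) (ltW r0); nra.
Qed.

Let T_gt0 : 0 < T.
Proof. by apply: lt_le_trans T_ge1. Qed.

Let T_le : T <= expR (v * d%:R).
Proof.
have h : u ^+ d <= expR (v * d%:R).
  by rewrite expRM_natr lerXn2r ?nnegrE ?expR_ge0 ?(ltW u_gt0)// expR_ge1Dx.
apply: le_trans h; rewrite T_val.
have : u^-1 ^+ d <= u ^+ d.
  have u1 : 1 <= u by rewrite /u; move: v_gt0; lra.
  apply: (@le_trans _ _ 1); last exact: exprn_ege1.
  by rewrite exprn_ile1 ?invr_ge0 ?(ltW u_gt0)// invf_le1 ?u_gt0.
lra.
Qed.

Let omNone : om None = rho / T.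
Proof.
rewrite /om; have t1 : 1 < t by move: a_gt0; rewrite /a; lra.
have TS : T * (\sum_(i < d.*2) (-1) ^+ i / y i) = Y by exact: sum_alt_inv.
rewrite -{1}TS; set S := \sum_(i < _) _ in TS *.
have S0 : S != 0.
  by apply/eqP => S0; move: Y_gt0; rewrite -TS S0 mulr0 ltxx.
by field; rewrite S0 gt_eqF// T_gt0.
Qed.

Let sum_alt_y i : (i < d)%N -> \sum_(j < d.*2) (-1) ^+ j * y j ^+ i = 0.
Proof.
move=> id; rewrite -[RHS](@sum_alt_poly R d ((t%:P - 'X) ^+ i)).
  by apply: eq_bigr => j _; rewrite horner_exp !hornerE.
apply: leq_trans (size_poly_exp_leq _ _) _.
have -> : size (t%:P - 'X : {poly R}) = 2 by rewrite -opprB size_polyN size_XsubC.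
by rewrite mul1n.
Qed.

(** Up to sign and a constant, y_j contributes the divided difference of x^k at 0, a, y_j. It is a
    polynomial in y_j of degree k - 2 (zero for k < 2), which the alternating signs annihilate. *)
Let om_moment k : (k < d)%N -> \sum_j om j * x j ^+ k = 0.
Proof.
move=> kd; rewrite 2!sum_option /= mulNr.
have -> : \sum_(j < d.*2) rho / Y * (a * ((-1) ^+ j / (y j * (y j - a)))) * y j ^+ k =
  rho / Y * \sum_(j < d.*2) a * ((-1) ^+ j / (y j * (y j - a))) * y j ^+ k.
  by rewrite mulr_sumr; apply: eq_bigr => j _; exact/esym/mulrA.
move: (rho / Y) => r.
rewrite -!mulrA -mulrN -!mulrDr [X in _ * X](_ : _ = 0) ?mulr0//.
rewrite !mulr_suml -sumrN -!big_split/=.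
case: k kd => [|k] kd.
  rewrite big1// => j _; rewrite !expr0; field.
  by rewrite !gt_eqF ?ya_gt0 ?y_gt0.
transitivity (\sum_(j < d.*2) \sum_(i < k) a * a ^+ (k.-1 - i) * ((-1) ^+ j * y j ^+ i)).
  apply: eq_bigr => j _.
  have h := subrXX a (y j) k.
  have {h}h : y j ^+ k - a ^+ k = (y j - a) * \sum_(i < k) a ^+ (k.-1 - i) * y j ^+ i.
    by rewrite -opprB h -mulNr opprB.
  rewrite expr0n/= mulr0 add0r.
  transitivity (a * (-1) ^+ j * ((y j ^+ k - a ^+ k) / (y j - a))).
    by rewrite !exprS; field; rewrite !gt_eqF ?ya_gt0 ?y_gt0.
  rewrite h [X in _ * X]mulrC mulKf ?gt_eqF ?ya_gt0// mulr_sumr.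
  by apply: eq_bigr => i _; ring.
rewrite exchange_big big1// => i _.
by rewrite -mulr_sumr sum_alt_y ?mulr0// (ltn_trans (ltn_ord i) (ltnW kd)).
Qed.

Let om_some j : `|om (Some (Some j))| = rho / Y * (a / (y j * (y j - a))).
Proof.
have -> : om (Some (Some j)) = (-1) ^+ j * (rho / Y * (a / (y j * (y j - a)))).
  by rewrite /om; ring.
rewrite normrM normr_sign mul1r ger0_norm//.
apply: mulr_ge0; apply: divr_ge0; [exact: ltW|exact/ltW/Y_gt0|exact/ltW/a_gt0|].
by apply: mulr_ge0; apply: ltW; [exact: y_gt0|exact: ya_gt0].
Qed.

Let omaE : `|om (Some None)| <= 2 * rho.
Proof.
rewrite /om normrN normrM (ger0_norm (divr_ge0 (ltW rho_gt0) (ltW Y_gt0))).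
have h : `|\sum_(i < d.*2) (-1) ^+ i / (y i - a)| <= 2 * Y.
  apply: le_trans (ler_norm_sum _ _ _) _.
  rewrite /Y mulr_sumr ler_sum// => i _.
  rewrite normrM normr_sign mul1r normfV ger0_norm ?(ltW (ya_gt0 i))//.
  rewrite ler_pdivlMr ?y_gt0// mulrC ler_pdivrMr ?ya_gt0//.
  by have := y_ge i; lra.
have rY : 0 <= rho / Y by apply: divr_ge0; [exact: ltW|exact/ltW/Y_gt0].
apply: le_trans (ler_wpM2l rY h) _.
by rewrite le_eqVlt; apply/orP; left; apply/eqP; field; rewrite gt_eqF// Y_gt0.
Qed.

(** The atom 0, the atom a and the nodes contribute at most rho, 2 rho and rho; for the last, y_j -
    a >= a gives a / (y_j (y_j - a)) <= 1 / y_j. *)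
Let om_norm : \sum_j `|om j| <= 4 * rho.
Proof.
rewrite 2!sum_option omNone.
have h1 : `|rho / T| <= rho.
  rewrite (ger0_norm (divr_ge0 (ltW rho_gt0) (ltW T_gt0))).
  by rewrite ler_pdivrMr ?T_gt0// ler_peMr ?T_ge1// ltW.
have h2 : \sum_j `|om (Some (Some j))| <= rho.
  under eq_bigr do rewrite om_some.
  rewrite -mulr_sumr -mulrA ler_piMr ?(ltW rho_gt0)// mulrC ler_pdivrMr ?Y_gt0// mul1r.
  rewrite ler_sum// => j _; rewrite ler_pdivrMr ?mulr_gt0 ?y_gt0 ?ya_gt0//.
  by rewrite mulKf ?gt_eqF ?y_gt0//; have := y_ge j; lra.
by move: omaE; lra.
Qed.

(** The node weights decay like 1 / y^2, so multiplying by y leaves a / (y - a) <= 2 a / y, whose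
    sum is still controlled by [Y]. *)
Let om_mean : \sum_j `|om j| * x j <= 4 * rho * a.
Proof.
rewrite 2!sum_option /x mulr0 add0r.
have h1 : `|om (Some None)| * a <= 2 * rho * a by rewrite ler_wpM2r ?(ltW a_gt0)// omaE.
have h2 : \sum_j `|om (Some (Some j))| * y j <= 2 * rho * a.
  rewrite [leRHS](_ : _ = rho / Y * (2 * a * Y)); last by field; rewrite gt_eqF ?Y_gt0.
  rewrite /Y !mulr_sumr -/Y ler_sum// => j _; rewrite om_some.
  rewrite -[leLHS]mulrA; apply: ler_wpM2l.
    exact: (divr_ge0 (ltW rho_gt0) (ltW Y_gt0)).
  rewrite [leLHS](_ : _ = a / (y j - a)); last by field; rewrite !gt_eqF ?y_gt0 ?ya_gt0.
  rewrite ler_pdivrMr ?ya_gt0// mulrAC ler_pdivlMr ?y_gt0//.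
  by have := y_ge j; move: a_gt0; nra.
by lra.
Qed.

(** As [om] has total mass 0, its positive and negative parts both have mass [m]. [P] takes one of
    them ([false] the positive one) and puts the missing mass at [a], which leaves the difference
    unchanged. *)
Let m : R := (\sum_j `|om j|) / 2.
Let atom_a : J := Some None.
Let P (s : bool) (j : J) : R :=
  (`|om j| + (-1) ^+ s * om j) / 2 + (j == atom_a)%:R * (1 - m).

Let sum_atom_a (f : J -> R) : \sum_j (j == atom_a)%:R * (1 - m) * f j = (1 - m) * f atom_a.
Proof.
rewrite (bigD1 atom_a)//= [X in _ + X]big1 => [|j /negbTE ->].
  by rewrite addr0 mul1r.
by rewrite !mul0r.
Qed.

Let m_ge0 : 0 <= m.
Proof. by rewrite /m divr_ge0// sumr_ge0. Qed.

Let m_le1 : m <= 1.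
Proof. by rewrite /m; move: om_norm rho_le; lra. Qed.

Let P_pmf s : is_pmf (P s).
Proof.
split=> [j|].
  rewrite /P addr_ge0// ?mulr_ge0 ?subr_ge0 ?m_le1// ?divr_ge0//.
  have := ler_norm (- ((-1) ^+ s * om j)).
  by rewrite normrN normrM normr_sign mul1r; lra.
have := @om_moment 0 d_gt0; under eq_bigr do rewrite expr0 mulr1.
move=> om0; rewrite /P big_split/= -mulr_suml big_split/= -mulr_sumr om0 mulr0 addr0.
have /= := sum_atom_a (fun=> 1); under eq_bigr do rewrite mulr1.
by move=> ->; rewrite /m; lra.
Qed.

Let P_mean s : \sum_j P s j * x j <= 2 * a.
Proof.
under eq_bigr do rewrite /P mulrDl.
rewrite big_split/= sum_atom_a.
have h : \sum_j (`|om j| + (-1) ^+ s * om j) / 2 * x j <= \sum_j `|om j| * x j.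
  rewrite ler_sum// => j _; rewrite ler_wpM2r//.
    case: j => [[j|]|]//=; first by rewrite ltW ?y_gt0.
    by rewrite ltW ?a_gt0.
  have := ler_norm ((-1) ^+ s * om j).
  by rewrite normrM normr_sign mul1r; lra.
rewrite [x _]/=.
by move: om_mean rho_le m_ge0 a_gt0 h; nra.
Qed.

Let P_diff j : P false j - P true j = om j.
Proof. by rewrite /P expr0 expr1; lra. Qed.

Lemma moment_matching :
  exists (J : finType) (x Pp Pm : J -> R) (j0 : J) (a : R),
  [/\ is_pmf Pp /\ is_pmf Pm,
      [/\ v ^+ 2 / 8 <= a, x j0 = 0 & forall j, j != j0 -> a <= x j <= 3],
      [/\ Pp j0 = 0, rho * expR (- (v * d%:R)) <= Pm j0 & Pm j0 <= rho],
      \sum_j Pp j * x j <= 2 * a /\ \sum_j Pm j * x j <= 2 * a &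
      (forall k, (k < d)%N -> \sum_j (Pm j - Pp j) * x j ^+ k = 0) /\
      \sum_j `|Pm j - Pp j| <= 1].
Proof.
(* [om] is positive at 0, so its negative part does not charge 0 and [P true] serves as P+. *)
exists J, x, (P true), (P false), None, a.
have T0 := T_gt0.
have om0 : 0 < om None by rewrite omNone divr_gt0 ?rho_gt0.
have Pm0 : P false None = rho / T.
  by rewrite /P mul0r addr0 expr0 mul1r (ger0_norm (ltW om0)) omNone; lra.
split.
- by split; apply: P_pmf.
- split=> [|//|[[j|]|]//= _]; first exact: a_ge.
    by rewrite y_le andbT; have := y_ge j; move: a_gt0; lra.
  by rewrite lexx/=; rewrite /a; move: t_le2; lra.
- split.
  + by rewrite /P mul0r addr0 expr1 mulN1r (ger0_norm (ltW om0)) subrr mul0r.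
  + by rewrite Pm0 expRN ler_wpM2l ?(ltW rho_gt0)// lef_pV2 ?posrE ?expR_gt0 ?T_le.
  + by rewrite Pm0 ler_pdivrMr// ler_peMr ?T_ge1 ?(ltW rho_gt0).
- by split; apply: P_mean.
- split=> [k kd|]; first by under eq_bigr do rewrite P_diff; exact: om_moment.
  by under eq_bigr do rewrite P_diff; move: om_norm rho_le; lra.
Qed.

End MomentMatching.

(** * Poisson mixtures *)

Section Poisson.
Variable R : realType.
Implicit Types (x y M : R) (k d r K : nat).

Lemma exp_series_le x K : 0 <= x -> \sum_(k < K) x ^+ k / k`!%:R <= expR x.
Proof.
move=> x0; rewrite -(big_mkord xpredT (fun k => x ^+ k / k`!%:R)).
apply: (nondecreasing_cvgn_le _ (is_cvg_series_exp_coeff x)).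
by apply: nondecreasing_series => n _ _; rewrite exp_coeff_ge0.
Qed.

Lemma exp_series_cvg x : (fun K => \sum_(k < K) x ^+ k / k`!%:R) @ \oo --> expR x.
Proof.
have -> : (fun K => \sum_(k < K) x ^+ k / k`!%:R) = series (exp_coeff x).
  by apply/funext => K; rewrite /series /= -(big_mkord xpredT (fun k => x ^+ k / k`!%:R)).
exact: is_cvg_series_exp_coeff.
Qed.

Lemma fact_term_le x r i : 0 <= x ->
  x ^+ (r + i) / (r + i)`!%:R <= x ^+ r / r`!%:R * (x ^+ i / i`!%:R).
Proof.
move=> x0; rewrite mulrACA -exprD ler_wpM2l ?exprn_ge0// -invfM.
rewrite lef_pV2 ?posrE ?mulr_gt0 ?ltr0n ?fact_gt0// -natrM ler_nat.
by rewrite -(@bin_fact (r + i) r) ?leq_addr// addKn leq_pmull// bin_gt0 leq_addr.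
Qed.

(** In absolute value, the tail term of index r + i is at most |y|^r / r! times |y|^i / i!; summing
    over i gives an exponential series. *)
Lemma exp_taylor y r :
  `|expR y - \sum_(k < r) y ^+ k / k`!%:R| <= `|y| ^+ r / r`!%:R * expR `|y|.
Proof.
set c := \sum_(k < r) _.
have cv : (fun K => `|\sum_(k < K) y ^+ k / k`!%:R - c|) @ \oo --> `|expR y - c|.
  by apply: cvg_norm; apply: cvgB; [exact: exp_series_cvg|exact: cvg_cst].
apply: (cvgr_to_le cv); exists r => // K /= rK.
rewrite -(subnKC rK) big_split_ord /= -/c [c + _]addrC addrK.
apply: le_trans (ler_norm_sum _ _ _) _.
apply: (@le_trans _ _ (\sum_(i < K - r) `|y| ^+ r / r`!%:R * (`|y| ^+ i / i`!%:R))).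
  apply: ler_sum => i _; rewrite normrM normfV normrX normr_nat.
  exact: fact_term_le.
by rewrite -mulr_sumr ler_wpM2l ?divr_ge0 ?exprn_ge0// exp_series_le.
Qed.

Definition pois x k : R := expR (- x) * (x ^+ k / k`!%:R).

Lemma pois_ge0 x k : 0 <= x -> 0 <= pois x k.
Proof. by move=> x0; rewrite mulr_ge0 ?expR_ge0// divr_ge0// exprn_ge0. Qed.

Lemma sum_pois_le1 x K : 0 <= x -> \sum_(k < K) pois x k <= 1.
Proof.
move=> x0; rewrite -mulr_sumr expRN ler_pdivrMl ?expR_gt0// mulr1.
exact: exp_series_le.
Qed.

Lemma sum_pois_cvg x : (fun K => \sum_(k < K) pois x k) @ \oo --> (1 : R).
Proof.
have -> : (fun K => \sum_(k < K) pois x k) =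
    (fun K => expR (- x) * \sum_(k < K) x ^+ k / k`!%:R).
  by apply/funext => K; rewrite mulr_sumr.
have e1 : expR (- x) * expR x = 1 by rewrite mulrC expRxMexpNx_1.
rewrite -[X in _ --> X]e1.
by apply: cvgM; [exact: cvg_cst|exact: exp_series_cvg].
Qed.

Lemma sum_pois_ge x (e : R) : 0 < e ->
  \forall K \near \oo, 1 - e <= \sum_(k < K) pois x k.
Proof.
move=> e0; apply: (cvgr_ge _ (@sum_pois_cvg x)); lra.
Qed.

(** For k < s one has 2^k <= e^k <= e^s, so inserting the factor e^s / 2^k turns the sum into an
    exponential series at x / 2. *)
Lemma pois_lower_tail x (s : R) K : 0 <= x ->
  \sum_(k < K | k%:R < s) pois x k <= expR (s - x / 2).
Proof.
move=> x0.
have h k : k%:R < s -> pois x k <= expR (s - x) * ((x / 2) ^+ k / k`!%:R).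
  move=> ks; rewrite /pois expRD exprMn exprVn.
  rewrite [leRHS](_ : _ = expR (- x) * (x ^+ k / k`!%:R) * (expR s / 2 ^+ k)); last first.
    by field; rewrite expf_neq0 ?pnatr_eq0// -lt0n fact_gt0.
  rewrite ler_peMr//; first by rewrite mulr_ge0 ?expR_ge0// divr_ge0// exprn_ge0.
  rewrite ler_pdivlMr ?exprn_gt0// mul1r.
  apply: (@le_trans _ _ (expR k%:R)); last by rewrite ler_expR ltW.
  rewrite -[k%:R]mulr1 expRM_natl lerXn2r ?nnegrE ?expR_ge0//.
  by have := @expR_ge1Dx R 1; lra.
apply: (@le_trans _ _ (\sum_(k < K) expR (s - x) * ((x / 2) ^+ k / k`!%:R))).
  rewrite big_mkcond /= ler_sum// => k _; case: ifPn => [/h//|_].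
  by rewrite mulr_ge0 ?expR_ge0// divr_ge0// exprn_ge0// divr_ge0.
rewrite -mulr_sumr (_ : s - x / 2 = s - x + x / 2); last lra.
by rewrite (expRD (s - x)) ler_wpM2l ?expR_ge0// exp_series_le// divr_ge0.
Qed.

(** With exp (- x) replaced by its first d - k Taylor terms, x^k exp (- x) becomes a polynomial of
    degree < d, which [w] annihilates. Only the remainder is left, and 1 / (k! (d - k)!) is the
    binomial over d!. *)
Lemma pois_mix_diff_le (J : finType) (w x : J -> R) M d k :
  (forall j, 0 <= x j <= M) ->
  (forall i, (i < d)%N -> \sum_j w j * x j ^+ i = 0) -> (k < d)%N ->
  `|\sum_j w j * pois (x j) k| <=
    (\sum_j `|w j|) * (M ^+ d / d`!%:R) * (expR M * 'C(d, k)%:R).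
Proof.
move=> xM w0 kd.
pose p (z : R) := \sum_(i < d - k) (- z) ^+ i / i`!%:R.
have -> : \sum_j w j * pois (x j) k =
    \sum_j w j * (x j ^+ k / k`!%:R * (expR (- x j) - p (x j))).
  apply/eqP; rewrite -subr_eq0 -sumrB.
  rewrite (eq_bigr (fun j => \sum_(i < d - k)
     (-1) ^+ i / (i`!%:R * k`!%:R) * (w j * x j ^+ (k + i)))) => [|j _].
    rewrite exchange_big big1// => i _.
    by rewrite -mulr_sumr w0 ?mulr0//; have := ltn_ord i; lia.
  rewrite (_ : _ - _ = w j * (x j ^+ k / k`!%:R) * p (x j)); last by rewrite /pois; ring.
  rewrite mulr_sumr; apply: eq_bigr => i _; by rewrite exprD (exprNn (x j)) invfM; ring.
apply: le_trans (ler_norm_sum _ _ _) _.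
rewrite -mulrA mulr_suml ler_sum// => j _; rewrite normrM ler_wpM2l//.
have /andP[x0 xle] := xM j; have M0 := le_trans x0 xle.
rewrite normrM ger0_norm ?divr_ge0 ?exprn_ge0//.
have := exp_taylor (- x j) (d - k); rewrite normrN (ger0_norm x0) => hT.
apply: (@le_trans _ _ (x j ^+ k / k`!%:R * (x j ^+ (d - k) / (d - k)`!%:R * expR (x j)))).
  by rewrite ler_wpM2l ?divr_ge0 ?exprn_ge0.
rewrite mulrA mulrACA -exprD subnKC ?(ltnW kd)// -invfM.
have -> : (k`!%:R * (d - k)`!%:R)^-1 = 'C(d, k)%:R / d`!%:R :> R.
  rewrite -(bin_fact (ltnW kd)) !natrM; field.
  by rewrite !pnatr_eq0 -!lt0n !fact_gt0 bin_gt0 ltnW.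
rewrite [leRHS](_ : _ = M ^+ d * ('C(d, k)%:R / d`!%:R) * expR M); last ring.
rewrite ler_pM ?mulr_ge0 ?exprn_ge0 ?divr_ge0 ?expR_ge0 ?ler_expR//.
by rewrite ler_wpM2r ?divr_ge0// lerXn2r ?nnegrE.
Qed.

(** For counts of at least [d] each Poisson weight is small by itself, because (d + i)! >= d! i!. *)
Lemma pois_mix_diff_ge (J : finType) (w x : J -> R) M d i :
  (forall j, 0 <= x j <= M) ->
  `|\sum_j w j * pois (x j) (d + i)| <=
    (\sum_j `|w j|) * (M ^+ d / d`!%:R) * (M ^+ i / i`!%:R).
Proof.
move=> xM; apply: le_trans (ler_norm_sum _ _ _) _.
rewrite -mulrA mulr_suml ler_sum// => j _; rewrite normrM ler_wpM2l//.
have /andP[x0 xle] := xM j; have M0 := le_trans x0 xle.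
rewrite ger0_norm ?pois_ge0//.
apply: (@le_trans _ _ (x j ^+ (d + i) / (d + i)`!%:R)).
  by rewrite ler_piMl ?divr_ge0 ?exprn_ge0// expR_le1 oppr_le0.
apply: le_trans (fact_term_le _ _ M0).
by rewrite ler_wpM2r// lerXn2r ?nnegrE.
Qed.

Lemma pois_mix_tv (J : finType) (w x : J -> R) M d K :
  0 <= M -> (forall j, 0 <= x j <= M) ->
  (forall i, (i < d)%N -> \sum_j w j * x j ^+ i = 0) ->
  \sum_(k < K) `|\sum_j w j * pois (x j) k| <=
    (\sum_j `|w j|) * (M ^+ d / d`!%:R) * (expR M * (2 ^+ d + 1)).
Proof.
move=> M0 xM w0; set D := (_ * (M ^+ d / _)).
have D0 : 0 <= D by rewrite mulr_ge0 ?sumr_ge0// divr_ge0// exprn_ge0.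
pose F (k : nat) : R := `|\sum_j w j * pois (x j) k|.
apply: (@le_trans _ _ (\sum_(k < d + K) F k)).
  rewrite [X in _ <= X](_ : _ = \sum_(k < K + d) F k); last by rewrite addnC.
  by rewrite big_split_ord /= lerDl sumr_ge0// => i _; rewrite normr_ge0.
rewrite big_split_ord /= mulrDr mulr1 mulrDr lerD//.
  apply: (@le_trans _ _ (\sum_(k < d) D * (expR M * 'C(d, k)%:R))).
    by apply: ler_sum => k _; apply: pois_mix_diff_le.
  rewrite -!mulr_sumr !ler_wpM2l ?expR_ge0//.
  rewrite -natr_sum -natrX ler_nat.
  have -> : (2 ^ d = \sum_(i < d.+1) 'C(d, i))%N.
    by rewrite -(addn1 1) expnDn; apply: eq_bigr => i _; rewrite !exp1n !muln1.
  by rewrite big_ord_recr /= leq_addr.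
apply: (@le_trans _ _ (\sum_(i < K) D * (M ^+ i / i`!%:R))).
  by apply: ler_sum => i _; apply: pois_mix_diff_ge.
by rewrite -mulr_sumr ler_wpM2l// exp_series_le.
Qed.

End Poisson.

(** * Finite mixtures of histogram laws *)

Section FiniteMixtures.
Variable R : realType.

Lemma esum_finType (T : choiceType) (H : finType) (e : H -> T) (f : T -> R) :
  injective e -> (forall x, 0 <= f x) -> (forall x, (forall h, x != e h) -> f x = 0) ->
  \esum_(x in [set: T]) (f x)%:E = (\sum_h f (e h))%:E.
Proof.
move=> einj f0 fout.
rewrite (esumID (e @` setT)) => [|i _]; last by rewrite lee_fin.
rewrite [X in (_ + X)%E]esum1 ?adde0 => [|x [_ /= nx]]; last first.
  by rewrite fout// => h; apply/eqP => xe; apply: nx; exists h.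
rewrite setTI esum_image => [|x y _ _]; last exact: einj.
rewrite esum_fset; [|exact: finite_finset|by move=> i _; rewrite lee_fin].
rewrite -sumEFin -big_enum /= [RHS]fsbig_seq ?enum_uniq//.
rewrite (_ : [set` enum _] = setT)//.
by apply/seteqP; split=> x //= _; rewrite mem_enum.
Qed.

Lemma tv_dist_finite (T : choiceType) (H : finType) (e : H -> T) (f g : T -> R) :
  injective e -> (forall x, (forall h, x != e h) -> f x = 0 /\ g x = 0) ->
  tv_dist f g = (2^-1 * \sum_h `|f (e h) - g (e h)|)%:E.
Proof.
move=> einj out; rewrite /tv_dist (esum_finType einj)// => x /out[-> ->].
by rewrite subrr normr0.
Qed.

(** A weighted sum of Dirac masses on [nat], where every function is measurable. *)
Lemma finite_prob (N : nat) (q : nat -> R) : (forall k, 0 <= q k) ->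
  \sum_(k < N) q k = 1 ->
  exists P : probability nat R, forall f : nat -> R, (forall k, 0 <= f k) ->
    \int[P]_k f k = \sum_(k < N) q k * f k.
Proof.
move=> q0 q1.
pose mu : {measure set nat -> \bar R} := msum (fun k => mscale (NngNum (q0 k)) \d_k) N.
have mu1 : mu setT = 1%E.
  rewrite /mu /msum /= -[RHS]/(1%:E) -q1 -sumEFin; apply: eq_bigr => k _.
  by rewrite -[LHS]/((q k)%:E * \d_(nat_of_ord k) setT)%E diracT mule1.
(* The total mass is already 1; normalising only supplies the probability structure. *)
exists (mnormalize mu \d_0%N) => f f0.
rewrite /Rintegral.
rewrite (eq_measure_integral mu); last first.
  move=> A mA _; change (mnormalize mu \d_0%N A = mu A).
  by rewrite /mnormalize mu1 eqe oner_eq0 /= invr1 mule1.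
rewrite ge0_integral_measure_sum//=; last by move=> k _; rewrite lee_fin.
rewrite -[RHS]/(fine (\sum_(k < N) q k * f k)%:E) -sumEFin; congr fine.
apply: eq_bigr => k _.
rewrite ge0_integral_mscale//=; last by move=> i _; rewrite lee_fin.
by rewrite integral_dirac//= diracT mul1e EFinM.
Qed.

Lemma iid_hist_law_ge0 (n N : nat) (p : 'I_n -> R) h :
  (forall i, 0 <= p i) -> 0 <= iid_hist_law N p h.
Proof. by move=> p0; apply: sumr_ge0 => x _; apply: prodr_ge0. Qed.

Lemma finite_mixture (n : nat) (W : finType) (G : pred W) (p : W -> R)
    (D : W -> 'I_n -> R) (N : W -> nat) :
  (forall w, 0 <= p w) -> 0 < \sum_(w | G w) p w ->
  (forall w, G w -> is_distr (D w)) ->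
  exists H : hist_mixture R n,
    (forall w : mix_space H,
      exists2 w', G w' & mix_distr w = D w' /\ mix_size w = N w') /\
    (forall h, mix_law H h =
      (\sum_(w | G w) p w * iid_hist_law (N w) (D w) h) / \sum_(w | G w) p w).
Proof.
move=> p0 g0 GD; set g := \sum_(w | G w) p w in g0 *.
have [w0 Gw0] : exists w0, G w0.
  apply/existsP; apply: contraTT g0 => /existsPn nG.
  by rewrite /g big_pred0 ?ltxx// => w; apply/negbTE/nG.
pose s := enum G.
have sG k : G (nth w0 s k).
  (* Indices past the end default to [w0], itself in [G], so the properties hold at every point of
     the space and not merely almost surely. *)
  have [ks|ks] := ltnP k (size s); last by rewrite nth_default.
  by have := mem_nth w0 ks; rewrite mem_enum.
pose q k := p (nth w0 s k) / g.
have q0 k : 0 <= q k by rewrite /q divr_ge0// ltW.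
have sumE (F : W -> R) : \sum_(k < size s) F (nth w0 s k) = \sum_(w | G w) F w.
  by rewrite -[RHS](big_enum _ _ G) /= -/s (big_nth w0) big_mkord.
have q1 : \sum_(k < size s) q k = 1.
  by rewrite -mulr_suml sumE divff// gt_eqF.
have [P PE] := finite_prob q0 q1.
pose H := @HistMixture R n _ nat P (fun k => D (nth w0 s k)) (fun k => N (nth w0 s k))
  (fun i => fun _ _ _ => Logic.I) (fun _ _ _ => Logic.I) (fun k => GD _ (sG k)).
exists H; split=> [k|h]; first by exists (nth w0 s k).
rewrite /mix_law /= PE => [|k]; last first.
  by apply: iid_hist_law_ge0 => i; have [] := GD _ (sG k).
rewrite mulr_suml -sumE; apply: eq_bigr => k _; rewrite /q mulrAC //.
Qed.

End FiniteMixtures.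

(** * Multinomial laws and product distances *)

Section Multinomial.
Variables (R : realType) (n : nat).
Implicit Types (u p : 'I_n -> R) (h : {ffun 'I_n -> nat}) (N K : nat).

Lemma big_tuple_cons (T : finType) N (F : N.+1.-tuple T -> R) :
  \sum_t F t = \sum_i \sum_(t : N.-tuple T) F [tuple of i :: t].
Proof.
rewrite pair_bigA /= (reindex (fun q : T * N.-tuple T => [tuple of q.1 :: q.2]))//=.
exists (fun t => (thead t, [tuple of behead t])) => [[i t] _|t _] /=.
  by rewrite theadE; congr pair; apply: val_inj.
by rewrite [RHS]tuple_eta; apply: val_inj.
Qed.

Definition hist_sub h i : {ffun 'I_n -> nat} := [ffun j => (h j - (j == i))%N].

Lemma histogram_cons i (t : seq 'I_n) h :
  (histogram (i :: t) == h) = (0 < h i)%N && (histogram t == hist_sub h i).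
Proof.
apply/eqP/andP => [<-|[h0 /eqP e]].
  rewrite ffunE /= eqxx; split=> //; apply/eqP/ffunP => j.
  by rewrite !ffunE /= eq_sym addKn.
apply/ffunP => j; have := congr1 (fun f : {ffun _} => f j) e.
rewrite !ffunE /=; have [<-|ij] := eqVneq i j => /=; lia.
Qed.

Lemma iid_hist_lawS N u h :
  iid_hist_law N.+1 u h = \sum_(i | (0 < h i)%N) u i * iid_hist_law N u (hist_sub h i).
Proof.
rewrite /iid_hist_law big_mkcond big_tuple_cons [RHS]big_mkcond.
apply: eq_bigr => i _; case: ifPn => hi; last first.
  by rewrite big1// => t _; rewrite histogram_cons (negbTE hi).
rewrite mulr_sumr [RHS]big_mkcond; apply: eq_bigr => t _.
rewrite histogram_cons hi /=; case: ifP => // _.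
rewrite big_ord_recl tnth0; congr (_ * _); apply: eq_bigr => j _.
by rewrite tnthS.
Qed.

Lemma prod_hist_sub h i (F : 'I_n -> nat -> R) :
  \prod_j F j (hist_sub h i j) = F i (h i).-1 * \prod_(j | j != i) F j (h j).
Proof.
rewrite (bigD1 i)//= ffunE eqxx subn1; congr (_ * _).
by apply: eq_bigr => j /negbTE ji; rewrite ffunE ji subn0.
Qed.

Lemma sum_hist_sub h i : (0 < h i)%N ->
  (\sum_j h j = (\sum_j hist_sub h i j).+1)%N.
Proof.
move=> hi; rewrite (bigD1 i)//= [in RHS](bigD1 i)//= ffunE eqxx.
rewrite -addSn; congr (_ + _)%N; first by lia.
by apply: eq_bigr => j /negbTE ji; rewrite ffunE ji subn0.
Qed.

(** The multinomial formula with denominators cleared. Splitting on the first sample i gives [h i]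
    times a common value, and the [h i] add up to the number of samples. *)
Lemma iid_hist_law_multinomial N u h :
  iid_hist_law N u h * \prod_i (h i)`!%:R =
  if (\sum_i h i == N)%N then N`!%:R * \prod_i u i ^+ h i else 0.
Proof.
elim: N h => [|N IH] h.
  rewrite /iid_hist_law big_mkcond (big_pred1 [tuple]) => [|t]; last first.
    by rewrite (tuple0 t) /= eqxx.
  rewrite big_ord0; case: eqP => [<-|hn].
    rewrite big1 => [|i _]; last by rewrite ffunE.
    rewrite big1 => [|i _]; last by rewrite ffunE.
    by rewrite big1 ?mulr1 // => i _; rewrite ffunE expr0.
  rewrite mul0r; case: eqP => // /eqP; rewrite sum_nat_eq0 => /forallP h0.
  case: hn; apply/ffunP => i; rewrite ffunE /=; by have /eqP -> := h0 i.
rewrite iid_hist_lawS mulr_suml.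
have step i : (0 < h i)%N ->
    u i * iid_hist_law N u (hist_sub h i) * \prod_j (h j)`!%:R =
    (h i)%:R * (if (\sum_j h j == N.+1)%N then N`!%:R * \prod_j u j ^+ h j else 0).
  move=> hi; have /(congr1 (fun z => z * (u i * (h i)%:R))) := IH (hist_sub h i).
  rewrite (prod_hist_sub _ _ (fun _ m => m`!%:R)) (prod_hist_sub _ _ (fun j m => u j ^+ m)).
  rewrite (sum_hist_sub hi) eqSS.
  have -> : \prod_j (h j)`!%:R =
      (h i)%:R * ((h i).-1`!%:R * \prod_(j | j != i) (h j)`!%:R) :> R.
    by rewrite (bigD1 i)//= mulrA -natrM -{2}(prednK hi) -factS (prednK hi).
  have -> : \prod_j u j ^+ h j = u i * (u i ^+ (h i).-1 * \prod_(j | j != i) u j ^+ h j).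
    by rewrite (bigD1 i)//= mulrA -exprS (prednK hi).
  move=> e; transitivity ((iid_hist_law N u (hist_sub h i) *
     ((h i).-1`!%:R * \prod_(j | j != i) (h j)`!%:R)) * (u i * (h i)%:R)); first by ring.
  rewrite e; case: ifP => _; last by rewrite mul0r mulr0.
  ring.
rewrite (eq_bigr _ step) -mulr_suml -natr_sum.
have -> : (\sum_(i | 0 < h i) h i = \sum_i h i)%N.
  by rewrite big_mkcond; apply: eq_bigr => i _; case: (h i).
case: ifP => [/eqP ->|_]; last by rewrite mulr0.
by rewrite factS natrM mulrA.
Qed.

Lemma iid_hist_law_out N u h : (\sum_i h i != N)%N -> iid_hist_law N u h = 0.
Proof.
move=> hN; have := iid_hist_law_multinomial N u h; rewrite (negbTE hN).
move/eqP; rewrite mulf_eq0 => /orP[/eqP//|/prodf_eq0[i _]].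
by rewrite pnatr_eq0 eqn0Ngt fact_gt0.
Qed.

(* Poissonization: the counts of a Poisson number of samples are independent. *)
Lemma pois_iid_hist_law N u h : 0 < \sum_i u i ->
  pois (\sum_i u i) N * iid_hist_law N (fun i => u i / \sum_j u j) h =
  if (\sum_i h i == N)%N then \prod_i pois (u i) (h i) else 0.
Proof.
move=> S0; case: ifPn => [/eqP hN|hN]; last by rewrite iid_hist_law_out// mulr0.
have f0 : \prod_i (h i)`!%:R != 0 :> R.
  by apply/prodf_neq0 => i _; rewrite pnatr_eq0 -lt0n fact_gt0.
apply: (mulIf f0); rewrite -mulrA iid_hist_law_multinomial hN eqxx.
have -> : \prod_i (u i / \sum_j u j) ^+ h i = (\prod_i u i ^+ h i) / (\sum_j u j) ^+ N.
  rewrite -hN expr_sum -prodf_div; apply: eq_bigr => i _; by rewrite exprMn exprVn.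
rewrite /pois !big_split /= prodfV -expR_sum sumrN.
by field; rewrite f0 expf_neq0 ?gt_eqF//= pnatr_eq0 -lt0n fact_gt0.
Qed.

(** Laws of boundedly many samples live on the image of this finite type, which reduces total
    variation to a finite sum. *)
Definition hist_of_ord K (h : {ffun 'I_n -> 'I_K}) : {ffun 'I_n -> nat} :=
  [ffun i => val (h i)].

Lemma hist_of_ord_inj K : injective (@hist_of_ord K).
Proof.
move=> h g /ffunP e; apply/ffunP => i; apply: val_inj.
by have := e i; rewrite !ffunE.
Qed.

Lemma iid_hist_law_out_range K N u h : (N < K)%N ->
  (forall g : {ffun 'I_n -> 'I_K}, h != hist_of_ord g) -> iid_hist_law N u h = 0.
Proof.
move=> NK hg; apply: big1 => t /eqP th; exfalso.
have hK i : (h i < K)%N.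
  by rewrite -th ffunE (leq_ltn_trans (count_size _ _))// size_tuple.
have /eqP := hg [ffun i => Ordinal (hK i)]; apply; apply/ffunP => i.
by rewrite !ffunE.
Qed.

Lemma sum_tuple_prod N p : \sum_(t : N.-tuple 'I_n) \prod_(j < N) p (tnth t j) =
  (\sum_i p i) ^+ N.
Proof.
elim: N => [|N IH].
  rewrite (big_pred1 [tuple]) => [|t]; last by rewrite (tuple0 t) /= eqxx.
  by rewrite big_ord0.
rewrite big_tuple_cons exprS -IH mulr_suml; apply: eq_bigr => i _.
rewrite mulr_sumr; apply: eq_bigr => t _; rewrite big_ord_recl tnth0; congr (_ * _).
by apply: eq_bigr => j _; rewrite tnthS.
Qed.

Lemma sum_iid_hist_law K N p : (N < K)%N -> \sum_i p i = 1 ->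
  \sum_(h : {ffun 'I_n -> 'I_K}) iid_hist_law N p (hist_of_ord h) = 1.
Proof.
move=> NK p1; rewrite /iid_hist_law (exchange_big_dep xpredT)//=.
transitivity ((\sum_i p i) ^+ N); last by rewrite p1 expr1n.
rewrite -sum_tuple_prod; apply: eq_bigr => t _.
have hK i : (histogram t i < K)%N.
  by rewrite ffunE (leq_ltn_trans (count_size _ _))// size_tuple.
rewrite (big_pred1 [ffun i => Ordinal (hK i)])// => g /=.
rewrite -(inj_eq (@hist_of_ord_inj K)) eq_sym; congr (_ == _).
by apply/ffunP => i; rewrite [RHS]ffunE [in RHS]ffunE.
Qed.

End Multinomial.

(** * Total variation between product laws *)

Section ProductTV.
Variable R : realType.

(** The factors are exchanged one at a time. *)
Lemma prod_hybrid (n : nat) (a b : 'I_n -> R) :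
  (forall i, 0 <= a i) -> (forall i, 0 <= b i) ->
  `|\prod_i a i - \prod_i b i| <=
  \sum_(i < n) \prod_(j < n)
    (if (j < i)%N then a j else if (j == i :> nat) then `|a j - b j| else b j).
Proof.
elim: n a b => [|n IH] a b a0 b0; first by rewrite !big_ord0 subrr normr0.
rewrite !big_ord_recr /=.
set A := \prod_(i < n) a _; set B := \prod_(i < n) b _; set l := ord_max.
have -> : A * a l - B * b l = (A - B) * b l + A * (a l - b l) by ring.
apply: le_trans (ler_normD _ _) _; rewrite lerD//.
  rewrite normrM (ger0_norm (b0 _)).
  have := IH (fun i => a (widen_ord (leqnSn n) i)) (fun i => b (widen_ord (leqnSn n) i))
    (fun i => a0 _) (fun i => b0 _).
  move=> /(ler_wpM2r (b0 l)) /le_trans -> //.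
  rewrite mulr_suml ler_sum// => i _; rewrite big_ord_recr /=.
  by rewrite ltnNge (ltnW (ltn_ord i)) /= gtn_eqF.
rewrite normrM ger0_norm; last by apply: prodr_ge0.
rewrite ltnn eqxx ler_wpM2r// ler_prod// => i _.
by rewrite ltn_ord a0 lexx.
Qed.

(** Summed over [h], a hybrid term factorizes: the exchanged coordinate gives the distance of the
    marginals, every other one a mass of at most 1. *)
Lemma product_tv (n K : nat) (a b : 'I_K -> R) :
  (forall k, 0 <= a k) -> (forall k, 0 <= b k) ->
  \sum_k a k <= 1 -> \sum_k b k <= 1 ->
  \sum_(h : {ffun 'I_n -> 'I_K}) `|\prod_i a (h i) - \prod_i b (h i)| <=
  n%:R * \sum_k `|a k - b k|.
Proof.
move=> a0 b0 a1 b1.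
pose c (i j : 'I_n) (k : 'I_K) :=
  if (j < i)%N then a k else if (j == i :> nat) then `|a k - b k| else b k.
apply: (@le_trans _ _ (\sum_(h : {ffun 'I_n -> 'I_K}) \sum_i \prod_j c i j (h j))).
  by apply: ler_sum => h _; apply: prod_hybrid.
rewrite exchange_big /= mulr_natl -[n in leRHS]card_ord -sumr_const ler_sum// => i _.
rewrite -(bigA_distr_bigA (fun j k => c i j k)) (bigD1 i)//=.
rewrite [X in X * _](_ : _ = \sum_k `|a k - b k|); last first.
  by apply: eq_bigr => k _; rewrite /c ltnn eqxx.
rewrite ler_piMr ?sumr_ge0// prodr_ile1// => j ji.
rewrite /c (_ : (j == i :> nat) = false); last exact/negbTE.
by case: (j < i)%N; rewrite ?a1 ?b1 ?andbT sumr_ge0.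
Qed.

End ProductTV.

(** * Conditioned Poissonized mixtures *)

Section ProductWeights.
Variables (R : realType) (n : nat) (J : finType) (P : J -> R).
Hypothesis (PP : is_pmf P).
Implicit Types (f : {ffun 'I_n -> J}).

Definition iid_weight f : R := \prod_i P (f i).

Lemma iid_weight_ge0 f : 0 <= iid_weight f.
Proof. by apply: prodr_ge0 => i _; apply: PP.1. Qed.

Lemma sum_iid_weight_prod (F : 'I_n -> J -> R) :
  \sum_f iid_weight f * \prod_i F i (f i) = \prod_i \sum_j P j * F i j.
Proof.
rewrite bigA_distr_bigA; apply: eq_bigr => f _.
by rewrite /iid_weight -big_split.
Qed.

Lemma sum_iid_weight : \sum_f iid_weight f = 1.
Proof.
transitivity (\sum_f iid_weight f * \prod_(i < n) 1).
  by apply: eq_bigr => f _; rewrite big1_eq mulr1.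
rewrite (sum_iid_weight_prod (fun _ _ => 1)); apply: big1 => i _.
by under eq_bigr do rewrite mulr1; exact: PP.2.
Qed.

Lemma sum_iid_weight_sum (g : J -> R) :
  \sum_f iid_weight f * \sum_i g (f i) = n%:R * \sum_j P j * g j.
Proof.
under eq_bigr do rewrite mulr_sumr.
rewrite exchange_big /= mulr_natl -[n in RHS]card_ord -sumr_const.
apply: eq_bigr => k _.
transitivity (\sum_f iid_weight f * \prod_i (if i == k then g (f i) else 1)).
  by apply: eq_bigr => f _; rewrite -big_mkcond big_pred1_eq.
rewrite (sum_iid_weight_prod (fun i j => if i == k then g j else 1)).
rewrite (bigD1 k)//= eqxx [X in _ * X]big1 ?mulr1// => i /negbTE ->.
by under eq_bigr do rewrite mulr1; exact: PP.2.
Qed.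

Lemma iid_markov (g : J -> R) (t : R) : 0 < t -> (forall j, 0 <= g j) ->
  \sum_(f : {ffun 'I_n -> J} | t < \sum_i g (f i)) iid_weight f <=
  n%:R * (\sum_j P j * g j) / t.
Proof.
move=> t0 g0; rewrite -sum_iid_weight_sum mulr_suml big_mkcond ler_sum// => f _.
have S0 : 0 <= \sum_i g (f i) by apply: sumr_ge0.
case: ifPn => [tS|_]; last by rewrite divr_ge0 ?mulr_ge0 ?iid_weight_ge0// ltW.
by rewrite -mulrA ler_peMr ?iid_weight_ge0// ler_pdivlMr// mul1r ltW.
Qed.

(** The indicator is at most exp (t - Z), Z being the number of coordinates equal to [j0]. As 1 / e
    <= 1 / 2, each factor has mean at most 1 - P j0 / 2 <= exp (- P j0 / 2). *)
Lemma iid_chernoff (j0 : J) (t : R) :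
  \sum_(f : {ffun 'I_n -> J} | \sum_i (f i == j0)%:R < t) iid_weight f <=
  expR (t - n%:R * P j0 / 2).
Proof.
pose F (j : J) : R := expR (- (j == j0)%:R).
have EF : \sum_j P j * F j <= expR (- (P j0 / 2)).
  rewrite (bigD1 j0)//= /F eqxx.
  rewrite (eq_bigr P) => [|j /negbTE ->]; last by rewrite oppr0 expR0 mulr1.
  have -> : \sum_(i | i != j0) P i = 1 - P j0.
    by have := PP.2; rewrite (bigD1 j0)//= => <-; ring.
  have e2 : expR (- 1) <= 2^-1 :> R.
    rewrite expRN lef_pV2 ?posrE ?expR_gt0//.
    by have := @expR_ge1Dx R 1; lra.
  have := expR_ge1Dx (- (P j0 / 2)); have := PP.1 j0; rewrite mulr1n; nra.
apply: (@le_trans _ _ (\sum_f iid_weight f * (expR t * \prod_i F (f i)))).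
  rewrite big_mkcond ler_sum// => f _; case: ifPn => [Zt|_]; last first.
    by rewrite !mulr_ge0 ?iid_weight_ge0 ?expR_ge0// prodr_ge0// => i _; rewrite expR_ge0.
  rewrite ler_peMr ?iid_weight_ge0// -expR_sum -expRD -[leLHS]expR0 ler_expR sumrN subr_ge0.
  exact: ltW.
under eq_bigr do rewrite mulrCA.
rewrite -mulr_sumr (sum_iid_weight_prod (fun _ => F)) prodr_const card_ord.
rewrite expRD ler_wpM2l ?expR_ge0//.
rewrite (_ : - (n%:R * P j0 / 2) = n%:R * - (P j0 / 2)); last ring.
rewrite expRM_natl lerXn2r ?nnegrE ?expR_ge0 ?sumr_ge0// => j _.
by rewrite mulr_ge0 ?expR_ge0// PP.1.
Qed.

End ProductWeights.

Section PoissonMixture.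
Variables (R : realType) (n K : nat) (J : finType) (x P : J -> R).
Hypotheses (x_ge0 : forall j, 0 <= x j) (PP : is_pmf P).
Variables (Gf : pred {ffun 'I_n -> J}) (s : R).
Hypothesis Gf_rate : forall f, Gf f -> 0 < \sum_i x (f i).
Implicit Types (f : {ffun 'I_n -> J}).

(** An outcome is a choice of atoms with a sample size, cut at [K] to keep the space finite. [G] is
    the conditioning event, [g] its weight, [F] the histogram law before division by [g]. *)
Let W : finType := ({ffun 'I_n -> J} * 'I_K)%type.
Let rate f : R := \sum_i x (f i).
Let D f (i : 'I_n) : R := x (f i) / rate f.
Let G (w : W) : bool := Gf w.1 && (s <= w.2%:R).
Let p (w : W) : R := iid_weight P w.1 * pois (rate w.1) w.2.
Let g : R := \sum_(w | G w) p w.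
Let F (h : {ffun 'I_n -> nat}) : R := \sum_(w | G w) p w * iid_hist_law w.2 (D w.1) h.

Definition pois_mix k : R := \sum_j P j * pois (x j) k.

Let rate_ge0 f : 0 <= rate f. Proof. by apply: sumr_ge0. Qed.

Let p_ge0 w : 0 <= p w.
Proof. by rewrite /p mulr_ge0 ?iid_weight_ge0// pois_ge0// rate_ge0. Qed.

Let D_distr f : Gf f -> is_distr (D f).
Proof.
move=> /Gf_rate f0; split=> [i|]; first by rewrite divr_ge0// rate_ge0.
by rewrite -mulr_suml divff// gt_eqF.
Qed.

Let F_ge0 h : 0 <= F h.
Proof.
apply: sumr_ge0 => w /andP[Gw _]; rewrite mulr_ge0 ?p_ge0//.
by apply: iid_hist_law_ge0; have [] := D_distr Gw.
Qed.

(** By Poissonization the sum over all outcomes would be exactly the product law; restricting to [G]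
    and to sizes below [K] only removes mass. *)
Let F_le (h : {ffun 'I_n -> nat}) : F h <= \prod_i pois_mix (h i).
Proof.
rewrite -(sum_iid_weight_prod P (fun i j => pois (x j) (h i))).
rewrite /F big_mkcond -(pair_bigA _ (fun f (N : 'I_K) => if G (f, N) then
  p (f, N) * iid_hist_law N (D f) h else 0)) /=.
apply: ler_sum => f _; set Q := \prod_i _.
have Q0 : 0 <= Q by apply: prodr_ge0 => i _; apply: pois_ge0.
have wQ0 : 0 <= iid_weight P f * Q by rewrite mulr_ge0// iid_weight_ge0.
rewrite /G /p /=; case: (boolP (Gf f)) => [Gff|_]; last by rewrite /= big1.
apply: (@le_trans _ _ (\sum_(N < K | (\sum_i h i == N)%N) iid_weight P f * Q)).
  rewrite [leRHS]big_mkcond ler_sum// => N _.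
  rewrite -mulrA (pois_iid_hist_law _ _ (Gf_rate Gff)).
  by case: (s <= _) => /=; case: ifP => _; rewrite ?mulr0.
have [hK|Kh] := ltnP (\sum_i h i) K.
  by rewrite (big_pred1 (Ordinal hK))// => N; rewrite /= eq_sym.
rewrite [leLHS]big1// => N /eqP hN; exfalso.
by have := ltn_ord N; rewrite -hN ltnNge Kh.
Qed.

Let sumF : \sum_(h : {ffun 'I_n -> 'I_K}) F (hist_of_ord h) = g.
Proof.
rewrite /F exchange_big /=; apply: eq_bigr => w /andP[Gw _].
by rewrite -mulr_sumr sum_iid_hist_law ?mulr1//; have [] := D_distr Gw.
Qed.

Lemma pois_mix_ge0 k : 0 <= pois_mix k.
Proof. by apply: sumr_ge0 => j _; rewrite mulr_ge0 ?pois_ge0// PP.1. Qed.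

Lemma sum_pois_mix_le1 : \sum_(k < K) pois_mix k <= 1.
Proof.
rewrite exchange_big /= -PP.2 ler_sum// => j _; rewrite -mulr_sumr ler_piMr ?PP.1//.
exact: sum_pois_le1.
Qed.

Let Q (h : {ffun 'I_n -> 'I_K}) : R := \prod_i pois_mix (h i).

Let sumQ : \sum_h Q h <= 1.
Proof.
rewrite /Q -(bigA_distr_bigA (fun (_ : 'I_n) (k : 'I_K) => pois_mix k)).
by rewrite prodr_ile1// => i _; rewrite sum_pois_mix_le1 andbT sumr_ge0// => k _; apply: pois_mix_ge0.
Qed.

(** [F] lies below both the conditioned law F / g and the product law [Q], whose masses are at most
    1, and has itself mass g >= 1 - (d1 + d2). Each of the two gaps thus costs at most d1 + d2. *)
Lemma conditioned_pois_mixture (d1 d2 : R) : 0 <= d1 -> 0 <= d2 -> d1 + d2 < 1 ->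
  \sum_(f | ~~ Gf f) iid_weight P f <= d1 ->
  (forall f, Gf f -> 1 - d2 <= \sum_(N < K | s <= N%:R) pois (\sum_i x (f i)) N) ->
  exists H : hist_mixture R n,
    [/\ forall w : mix_space H, s <= (mix_size w)%:R /\
          exists2 f, Gf f & mix_distr w = (fun i => x (f i) / \sum_i x (f i)),
        forall h, (forall k : {ffun 'I_n -> 'I_K}, h != hist_of_ord k) -> mix_law H h = 0 &
        \sum_(h : {ffun 'I_n -> 'I_K}) `|mix_law H (hist_of_ord h) - Q h| <= 2 * (d1 + d2)].
Proof.
move=> d10 d20 d12 hd1 hd2.
have g_ge : 1 - (d1 + d2) <= g.
  rewrite /g big_mkcond -(pair_bigA _ (fun f (N : 'I_K) => if G (f, N) then p (f, N) else 0)) /=.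
  have wG : 1 - d1 <= \sum_(f | Gf f) iid_weight P f.
    by have := sum_iid_weight n PP; rewrite (bigID Gf) /=; move: hd1; lra.
  apply: (@le_trans _ _ (\sum_(f | Gf f) iid_weight P f * (1 - d2))).
    rewrite -mulr_suml; have d21 : 0 <= 1 - d2 by lra.
    apply: le_trans (ler_wpM2r d21 wG); nra.
  rewrite big_mkcond ler_sum// => f _; rewrite /G /p /=; case: ifPn => [Gff|_].
    rewrite -big_mkcond /= -mulr_sumr ler_wpM2l ?iid_weight_ge0//.
    exact: hd2.
  by rewrite /= big1.
have g0 : 0 < g by lra.
have [H [HD HL]] := @finite_mixture R n W G p (fun w => D w.1) (fun w => w.2) p_ge0 g0
  (fun w Gw => D_distr (proj1 (andP Gw))).
have {}HL h : mix_law H h = F h / g by rewrite HL.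
exists H; split.
- move=> w; have [w' /andP[Gw sw] [-> ->]] := HD w; split=> //.
  by exists w'.1.
- move=> h hK; rewrite HL /F big1 ?mul0r// => w _.
  by rewrite (iid_hist_law_out_range _ (ltn_ord w.2))// mulr0.
- have FQ (h : {ffun 'I_n -> 'I_K}) : F (hist_of_ord h) <= Q h.
    by have := F_le (hist_of_ord h); rewrite /Q; under eq_bigr do rewrite ffunE.
  have gle1 : g <= 1.
    by rewrite -sumF; apply: le_trans sumQ; apply: ler_sum.
  apply: (@le_trans _ _ (\sum_(h : {ffun 'I_n -> 'I_K})
      ((F (hist_of_ord h) / g - F (hist_of_ord h)) + (Q h - F (hist_of_ord h))))).
    apply: ler_sum => h _; rewrite HL; set a := F _ / g; set b := F _.
    have ab : b <= a by rewrite /a ler_pdivlMr// ler_piMr// F_ge0.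
    have bQ : b <= Q h by exact: FQ.
    by rewrite ler_norml; apply/andP; split; lra.
  rewrite big_split /= !sumrB -mulr_suml sumF divff ?gt_eqF//.
  by move: sumQ; lra.
Qed.

End PoissonMixture.

(** * Indistinguishable mixtures *)

(** The conditioned laws are compared through the product laws: each conditioning has L1 cost 2 (d1
    + 2 d2), the products differ by n e, and total variation is half the sum. *)
Lemma pois_mixture_pair (R : realType) (n : nat) (J : finType) (x Pp Pm : J -> R)
    (Gp Gm : pred {ffun 'I_n -> J}) (s d1 d2 e : R) :
  (forall j, 0 <= x j) -> is_pmf Pp -> is_pmf Pm ->
  (forall f, Gp f || Gm f ->
     0 < \sum_i x (f i) /\ expR (s - (\sum_i x (f i)) / 2) <= d2) ->
  0 <= d1 -> 0 < d2 -> d1 + 2 * d2 < 1 ->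
  \sum_(f | ~~ Gp f) iid_weight Pp f <= d1 ->
  \sum_(f | ~~ Gm f) iid_weight Pm f <= d1 ->
  (forall K, \sum_(k < K) `|\sum_j (Pm j - Pp j) * pois (x j) k| <= e) ->
  exists Hp Hm : hist_mixture R n,
    [/\ forall w : mix_space Hp, s <= (mix_size w)%:R /\
          exists2 f, Gp f & mix_distr w = (fun i => x (f i) / \sum_i x (f i)),
        forall w : mix_space Hm, s <= (mix_size w)%:R /\
          exists2 f, Gm f & mix_distr w = (fun i => x (f i) / \sum_i x (f i)) &
        (tv_dist (mix_law Hp) (mix_law Hm) <=
          (2 * (d1 + 2 * d2) + n%:R * e / 2)%:E)%E].
Proof.
move=> x0 Pp1 Pm1 Grate d10 d20 d12 hp hm he.
have /choice[M HM] (f : {ffun 'I_n -> J}) : exists M, forall K, (M <= K)%N ->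
    1 - d2 <= \sum_(k < K) pois (\sum_i x (f i)) k.
  by have [M _ HM] := sum_pois_ge (\sum_i x (f i)) d20; exists M => K /HM.
(* One truncation level serves all the finitely many choices of atoms. *)
pose K := \max_f M f.
(* One [d2] pays for sizes of at least [K], the other for sizes below [s]. *)
have tail f : Gp f || Gm f ->
    1 - 2 * d2 <= \sum_(N < K | s <= N%:R) pois (\sum_i x (f i)) N.
  move=> /Grate[r0 rs].
  have := HM f K (leq_bigmax f); rewrite (bigID (fun N : 'I_K => s <= N%:R)) /=.
  under [X in _ <= _ + X -> _]eq_bigl do rewrite -ltNge.
  have := pois_lower_tail s K (ltW r0); lra.
have d2' : 0 <= 2 * d2 by lra.
have rp f : Gp f -> 0 < \sum_i x (f i) by move=> Gf; case: (Grate f); rewrite ?Gf.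
have rm f : Gm f -> 0 < \sum_i x (f i) by move=> Gf; case: (Grate f); rewrite ?Gf ?orbT.
have [Hp [Hp1 Hp2 Hp3]] := @conditioned_pois_mixture R n K J x Pp x0 Pp1 Gp s rp
  _ _ d10 d2' d12 hp (fun f Gf => tail f (introT orP (or_introl Gf))).
have [Hm [Hm1 Hm2 Hm3]] := @conditioned_pois_mixture R n K J x Pm x0 Pm1 Gm s rm
  _ _ d10 d2' d12 hm (fun f Gf => tail f (introT orP (or_intror Gf))).
exists Hp, Hm; split=> //.
rewrite (tv_dist_finite (@hist_of_ord_inj n K)); last by move=> h hK; rewrite Hp2 ?Hm2.
rewrite lee_fin.
pose Q P (h : {ffun 'I_n -> 'I_K}) : R := \prod_i pois_mix x P (h i).
have hQ : \sum_h `|Q Pp h - Q Pm h| <= n%:R * e.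
  apply: (@le_trans _ _ (n%:R * \sum_(k < K) `|pois_mix x Pp k - pois_mix x Pm k|)).
    by apply: (@product_tv R n K (fun k => pois_mix x Pp k) (fun k => pois_mix x Pm k));
      [move=> k; exact: pois_mix_ge0|move=> k; exact: pois_mix_ge0|
       exact: sum_pois_mix_le1|exact: sum_pois_mix_le1].
  rewrite ler_wpM2l// (le_trans _ (he K))// ler_sum// => k _.
  rewrite distrC /pois_mix -sumrB; under eq_bigr do rewrite -mulrBl.
  by [].
have tri : \sum_(h : {ffun 'I_n -> 'I_K})
      `|mix_law Hp (hist_of_ord h) - mix_law Hm (hist_of_ord h)| <=
    \sum_h `|mix_law Hp (hist_of_ord h) - Q Pp h| + \sum_h `|Q Pp h - Q Pm h| +
    \sum_h `|mix_law Hm (hist_of_ord h) - Q Pm h|.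
  rewrite -!big_split /= ler_sum// => h _.
  rewrite (distrC (mix_law Hm _)).
  apply: le_trans (lerD (ler_normD _ _) (lexx _)).
  by apply: le_trans (ler_normD _ _); rewrite le_eqVlt; apply/orP; left; apply/eqP; congr `|_|; ring.
move: Hp3 Hm3 hQ tri; rewrite -/(Q Pp) -/(Q Pm); lra.
Qed.

(** At a zero of p one has q >= T, so |p - q| >= 2 T [p = 0] + (p - q) everywhere. The last term
    sums to 0 and the 2 cancels the half in total variation. *)
Lemma far_of_zeros (R : realType) (n : nat) (T eps : R) (p : 'I_n -> R) :
  is_distr p -> 0 <= T -> eps <= (\sum_i (p i == 0)%:R) * T -> far_from_big T eps p.
Proof.
move=> [p0 p1] T0 epsT q [[q0 q1] Tq].
rewrite (tv_dist_finite (@inj_id 'I_n)); last by move=> x /(_ x); rewrite eqxx.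
rewrite lee_fin (le_trans epsT)// -[leLHS]mul1r -[X in X * _](@mulVf _ 2) ?pnatr_eq0//.
rewrite -mulrA ler_wpM2l ?invr_ge0//.
apply: (@le_trans _ _ (\sum_i (2 * ((p i == 0)%:R * T) + (p i - q i)))).
  by rewrite big_split /= sumrB p1 q1 subrr addr0 -mulr_sumr mulr_suml.
apply: ler_sum => i _; case: eqP => [->|_] /=.
  by rewrite mul1r sub0r normrN ger0_norm//; have := Tq i; lra.
by rewrite mul0r mulr0 add0r ler_norm.
Qed.

Lemma sum_union_bound (R : realType) (I : finType) (A B : pred I) (w : I -> R) (a b : R) :
  (forall i, 0 <= w i) -> \sum_(i | ~~ A i) w i <= a -> \sum_(i | ~~ B i) w i <= b ->
  \sum_(i | ~~ (A i && B i)) w i <= a + b.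
Proof.
move=> w0 ha hb; apply: le_trans (lerD ha hb).
rewrite [leLHS]big_mkcond [X in _ <= X + _]big_mkcond [X in _ <= _ + X]big_mkcond.
rewrite -big_split /= ler_sum// => i _.
by case: (A i); case: (B i) => /=; rewrite ?addr0 ?add0r ?lerDl.
Qed.

Lemma expRN_le (R : realType) (y c : R) : 0 < c -> c <= y -> expR (- y) <= c^-1.
Proof.
move=> c0 cy; rewrite expRN lef_pV2 ?posrE ?expR_gt0//.
by have := expR_ge1Dx y; lra.
Qed.

(** The moment-matching atoms with rho = 1 / B are scaled by [lam] into Poisson rates. The last five
    hypotheses in turn make the count laws close, the expected number of zero atoms large and the
    total rate large, and fit [s] and [eps] to them. *)
Lemma hard_mixtures (R : realType) (n d : nat) (B v lam s eps : R) :
  28 * 100 <= B ->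
  (0 < n)%N -> (0 < d)%N -> 0 < v -> v <= 1 -> 0 < lam ->
  n%:R * ((3 * lam) ^+ d / d`!%:R * (expR (3 * lam) * (2 ^+ d + 1))) <= 100^-1 ->
  4 * B ^+ 2 <= n%:R * expR (- (v * d%:R)) ->
  4 * B <= lam * n%:R * v ^+ 2 / 16 ->
  s <= lam * n%:R * v ^+ 2 / 64 ->
  eps <= expR (- (v * d%:R)) / (4 * B ^+ 2) ->
  exists Hp Hm : hist_mixture R n,
    [/\ (forall w : mix_space Hp, s <= (mix_size w)%:R)
          /\ (forall w : mix_space Hm, s <= (mix_size w)%:R),
        forall w : mix_space Hp, Big (B * n%:R)^-1 (mix_distr w),
        forall w : mix_space Hm, far_from_big (B * n%:R)^-1 eps (mix_distr w),
        (tv_dist (mix_law Hp) (mix_law Hm) <= (1 / 100)%:E)%E &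
        (forall (w : mix_space Hp) (i : 'I_n), mix_distr w i <= 48 / (n%:R * v ^+ 2))
          /\ (forall (w : mix_space Hm) (i : 'I_n), mix_distr w i <= 48 / (n%:R * v ^+ 2))].
Proof.
move=> B2800 n_gt0 d_gt0 v0 v1 lam0 Htv Hn Hm Hs Heps.
have n0 : 0 < n%:R :> R by rewrite ltr0n.
have B0 : 0 < B by lra.
have rho0 : 0 < B^-1 by rewrite invr_gt0.
have rho1 : B^-1 <= 8^-1 by rewrite lef_pV2 ?posrE//; lra.
have rhoB : B * B^-1 = 1 by rewrite mulfV ?gt_eqF.
have [] := @moment_matching R d v B^-1 d_gt0 v0 v1 rho0 rho1.
move=> J [x0 [Pp [Pm [j0 [a [[Pp1 Pm1] [a_ge x00 x0j] [Pp0 Pm_ge Pm_le] [mp mm] [mom absd]]]]]]].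
have v20 : 0 < v ^+ 2 by rewrite exprn_gt0.
have a0 : 0 < a by apply: lt_le_trans a_ge; rewrite divr_gt0.
set E := expR _ in Hn Heps Pm_ge.
have E0 : 0 < E by apply: expR_gt0.
pose z := Pm j0.
pose x j := lam * x0 j.
have xj0 : x j0 = 0 by rewrite /x x00 mulr0.
have xa j : j != j0 -> lam * a <= x j.
  by move=> /x0j/andP[h _]; rewrite /x ler_pM2l.
have x_ge0 j : 0 <= x j.
  have [->|/xa] := eqVneq j j0; first by rewrite xj0.
  by apply: le_trans; rewrite mulr_ge0 ?ltW.
have xle j : x j <= 3 * lam.
  have [->|/x0j/andP[_ h]] := eqVneq j j0; first by rewrite xj0 mulr_ge0 ?ltW.
  by rewrite mulrC /x ler_pM2l.
have la0 : 0 < lam * a by rewrite mulr_gt0.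
pose Z (f : {ffun 'I_n -> J}) : R := \sum_i (f i == j0)%:R.
pose rate (f : {ffun 'I_n -> J}) : R := \sum_i x (f i).
(* Under this bound a nonzero atom, being at least lam a, gets a share of at least 1 / (B n). *)
pose Gsum (f : {ffun 'I_n -> J}) : bool := rate f <= B * n%:R * (lam * a).
pose Gp (f : {ffun 'I_n -> J}) : bool := [forall i, f i != j0] && Gsum f.
(* A quarter of the mean number of zero atoms suffices for farness; at most n / 2 of them keeps the
   rate large. *)
pose Gm (f : {ffun 'I_n -> J}) : bool :=
  ((n%:R * z / 4 <= Z f) && (Z f <= n%:R / 2)) && Gsum f.
have rate_ge f : lam * a * (n%:R - Z f) <= rate f.
  have -> : n%:R - Z f = \sum_(i < n) (1 - (f i == j0)%:R).
    by rewrite sumrB sumr_const card_ord.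
  rewrite mulr_sumr ler_sum// => i _.
  have [->|/xa] := eqVneq (f i) j0; first by rewrite subrr mulr0 xj0.
  by rewrite subr0 mulr1.
have Zle f : Gp f || Gm f -> Z f <= n%:R / 2.
  case/orP => [/andP[/forallP fi _]|/andP[/andP[_ ->]]//].
  rewrite /Z big1 ?divr_ge0// => i _.
  by rewrite (negbTE (fi i)).
have rate_half f : Gp f || Gm f -> lam * a * (n%:R / 2) <= rate f.
  move=> /Zle Zf; apply: le_trans (rate_ge f); rewrite ler_pM2l//.
  by move: Zf; clear; lra.
have rate_m f : Gp f || Gm f -> lam * n%:R * v ^+ 2 / 16 <= rate f.
  move=> /rate_half; apply: le_trans.
  have : lam * n%:R * (v ^+ 2 / 8) <= lam * n%:R * a by rewrite ler_pM2l ?mulr_gt0.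
  by clear; lra.
have rate_pos f : Gp f || Gm f -> 0 < rate f.
  by move=> /rate_half; apply: lt_le_trans; rewrite !mulr_gt0.
have Gsum_bad P : is_pmf P -> \sum_j P j * x0 j <= 2 * a ->
    \sum_(f | ~~ Gsum f) iid_weight P f <= 2 * B^-1.
  move=> P1 mP; under eq_bigl do rewrite -ltNge.
  have t0 : 0 < B * n%:R * (lam * a) by rewrite !mulr_gt0.
  have /le_trans := @iid_markov R n J P P1 x _ t0 x_ge0; apply.
  rewrite ler_pdivrMr//.
  have -> : \sum_j P j * x j = lam * \sum_j P j * x0 j.
    by rewrite mulr_sumr; apply: eq_bigr => j _; rewrite /x mulrCA.
  have : n%:R * lam * (\sum_j P j * x0 j) <= n%:R * lam * (2 * a).
    by rewrite ler_pM2l ?mulr_gt0.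
  rewrite (_ : 2 * B^-1 * _ = B * B^-1 * (n%:R * lam * (2 * a))); last ring.
  by move=> h; rewrite rhoB mul1r [leLHS]mulrA.
have badp : \sum_(f | ~~ Gp f) iid_weight Pp f <= 5 * B^-1.
  rewrite (_ : 5 * B^-1 = 3 * B^-1 + 2 * B^-1); last by ring.
  apply: sum_union_bound; [exact: iid_weight_ge0| |exact: Gsum_bad].
  rewrite big1 ?mulr_ge0 ?(ltW rho0)// => f; rewrite negb_forall => /existsP[i]; rewrite negbK => /eqP fi.
  by rewrite /iid_weight (bigD1 i)//= fi Pp0 mul0r.
have zge : 4 * B <= n%:R * z.
  have h : n%:R * E / B <= n%:R * z by rewrite -mulrA [E / B]mulrC ler_pM2l.
  apply: le_trans h; rewrite ler_pdivlMr//.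
  by apply: le_trans Hn; rewrite expr2 mulrA.
(* Too few zero atoms cost 1 / B by Chernoff; too many, and too large a rate, cost 2 / B each by
   Markov. *)
have badm : \sum_(f | ~~ Gm f) iid_weight Pm f <= 5 * B^-1.
  rewrite (_ : 5 * B^-1 = (B^-1 + 2 * B^-1) + 2 * B^-1); last by ring.
  apply: sum_union_bound; [exact: iid_weight_ge0| |exact: Gsum_bad].
  apply: sum_union_bound; first exact: iid_weight_ge0.
    under eq_bigl do rewrite -ltNge.
    apply: le_trans (iid_chernoff _ _ _ _) _ => //.
    rewrite (_ : _ - _ = - (n%:R * z / 4)); last by rewrite /z; clear; lra.
    by apply: expRN_le => //; move: zge; clear; lra.
  under eq_bigl do rewrite -ltNge.
  have n20 : 0 < n%:R / 2 :> R by rewrite divr_gt0.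
  apply: le_trans (@iid_markov R n J Pm Pm1 (fun j => (j == j0)%:R) _ n20 _) _ => //.
  rewrite (_ : \sum_j _ = z); last first.
    rewrite (bigD1 j0)//= eqxx mulr1 big1 ?addr0// => j /negbTE ->.
    by rewrite mulr0.
  rewrite ler_pdivrMr//; have : n%:R * z <= n%:R * B^-1 by rewrite ler_pM2l.
  by clear; lra.
(* The final distance is 14 / B + 1 / 200, and 14 / B <= 1 / 200 for B >= 2800. *)
have rho7 : B^-1 <= 28^-1 * 100^-1.
  by rewrite -invfM lef_pV2 ?posrE ?mulr_gt0.
have [|||||Hp [Hm' [hp hm htv]]] := @pois_mixture_pair R n J x Pp Pm Gp Gm s (5 * B^-1) B^-1
  (n%:R^-1 / 100) x_ge0 Pp1 Pm1 _ _ _ _ badp badm _.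
- move=> f Gf; split; first exact: rate_pos.
  rewrite -/(rate f); have := rate_m f Gf => rm.
  rewrite (_ : s - _ = - (rate f / 2 - s)); last by ring.
  by apply: expRN_le => //; move: rm Hs Hm B0; clear; lra.
- by rewrite mulr_ge0 ?(ltW rho0).
- by [].
- by move: rho7; clear; lra.
- move=> K.
  have M0 : 0 <= 3 * lam by rewrite mulr_ge0// ltW.
  have xM j : 0 <= x j <= 3 * lam by rewrite x_ge0 xle.
  have momx k : (k < d)%N -> \sum_j (Pm j - Pp j) * x j ^+ k = 0.
    move=> /mom/(congr1 (fun r => lam ^+ k * r)); rewrite mulr0 mulr_sumr => h.
    by rewrite -[RHS]h; apply: eq_bigr => j _; rewrite /x exprMn; ring.
  apply: le_trans (pois_mix_tv K M0 xM momx) _.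
  rewrite -mulrA; set B' := (_ / _ * _) in Htv *.
  have B0' : 0 <= B'.
    by rewrite /B' !mulr_ge0 ?invr_ge0 ?exprn_ge0 ?expR_ge0 ?addr_ge0 ?exprn_ge0.
  apply: (@le_trans _ _ B'); first by rewrite ler_piMl.
  by rewrite mulrC ler_pdivlMr// mulrC.
exists Hp, Hm'.
(* No atom exceeds 3 lam, and the rate is at least lam n v^2 / 16. *)
have bound f : Gp f || Gm f -> forall i, x (f i) / rate f <= 48 / (n%:R * v ^+ 2).
  move=> Gf i; rewrite ler_pdivrMr ?rate_pos//; apply: le_trans (xle _) _.
  have nv0 : 0 < n%:R * v ^+ 2 by rewrite mulr_gt0.
  have := rate_m f Gf.
  by move=> h; rewrite [leRHS]mulrAC ler_pdivlMr//; move: h; clear; lra.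
have distr f : Gp f || Gm f -> is_distr (fun i => x (f i) / rate f).
  move=> Gf; split=> [i|]; first by rewrite divr_ge0// ltW// rate_pos.
  by rewrite -mulr_suml divff// gt_eqF// rate_pos.
split.
- by split=> w; [have [] := hp w|have [] := hm w].
- move=> w; have [_ [f Gf ->]] := hp w; have Gf' : Gp f || Gm f by rewrite Gf.
  split; first exact: distr.
  move: Gf => /andP[/forallP fi fs] i /=; rewrite -/(rate f) ler_pdivlMr ?rate_pos//.
  apply: le_trans (xa _ (fi i)).
  by rewrite ler_pdivrMl ?mulr_gt0.
- move=> w; have [_ [f Gf ->]] := hm w; have Gf' : Gp f || Gm f by rewrite Gf orbT.
  apply: far_of_zeros; [exact: distr|by rewrite invr_ge0 mulr_ge0 ?ler0n ?(ltW B0)|].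
  move: Gf => /andP[/andP[Zf _] _]; rewrite -/(rate f).
  have ZZ : Z f <= \sum_i (x (f i) / rate f == 0)%:R.
    apply: ler_sum => i _; have [->|_] := eqVneq (f i) j0; last by rewrite ler0n.
    by rewrite xj0 mul0r eqxx.
  rewrite ler_pdivlMr ?mulr_gt0//; apply: le_trans (le_trans Zf ZZ).
  (* There are at least n z / 4 >= n E / (4 B) zeros, each worth 1 / (B n). *)
  apply: (@le_trans _ _ (E / (4 * B ^+ 2) * (B * n%:R))).
    by rewrite ler_pM2r ?mulr_gt0.
  rewrite (_ : _ * _ = n%:R * (B^-1 * E) / 4); last by field; rewrite gt_eqF.
  by rewrite ler_pM2r// ler_pM2l.
- apply: le_trans htv _; rewrite lee_fin (_ : n%:R * _ = 100^-1); last by field; rewrite gt_eqF.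
  by move: rho7; clear; lra.
- split=> w i; [have [_ [f Gf ->]] := hp w|have [_ [f Gf ->]] := hm w];
    by apply: bound; rewrite Gf ?orbT.
Qed.

(** * Choice of the parameters *)

Lemma exp_fact_ge (R : realType) (d : nat) : d%:R ^+ d / d`!%:R <= expR 1 ^+ d :> R.
Proof.
rewrite -expRM_natl mulr1; case: d => [|d]; first by rewrite expr0 divr1 expR0.
by have := @expR_ge1Dxn R d.+1%:R d (ler0n _ _); lra.
Qed.

(** Here 3 lam = kap d n^(-1/d), whose d-th power cancels n. With d^d / d! <= e^d, exp (3 lam) <=
    e^d and 2^d + 1 <= 3^d, what remains is (3 e^2 kap)^d = 100^(-d). *)
Lemma pois_tv_small (R : realType) (n d : nat) (kap lam : R) : (0 < n)%N -> (0 < d)%N ->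
  kap = (3 * 10 ^+ 2 * expR 1 ^+ 2)^-1 -> 3 * lam = kap * d%:R * expR (- (ln n%:R / d%:R)) ->
  n%:R * ((3 * lam) ^+ d / d`!%:R * (expR (3 * lam) * (2 ^+ d + 1))) <= 100^-1.
Proof.
move=> n0 d0 kapE lamE; have nR : 0 < n%:R :> R by rewrite ltr0n.
have dR : 0 < d%:R :> R by rewrite ltr0n.
set e1 : R := expR 1 in kapE *.
have e1_ge1 : 1 <= e1 by have := @expR_ge1Dx R 1; rewrite /e1; lra.
have e1_gt0 : 0 < e1 by lra.
have kap0 : 0 < kap by rewrite kapE invr_gt0 !mulr_gt0 ?exprn_gt0.
have kap1 : kap <= 1.
  rewrite kapE invf_le1 ?mulr_gt0 ?exprn_gt0//.
  have : 1 <= e1 ^+ 2 by rewrite exprn_ege1.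
  lra.
set q := expR (- _) in lamE.
have qd : q ^+ d = n%:R^-1.
  rewrite /q -expRM_natl mulrN mulrCA divff ?gt_eqF// mulr1 expRN lnK//.
have q0 : 0 < q by apply: expR_gt0.
have q1 : q <= 1.
  by rewrite /q expR_le1 oppr_le0 divr_ge0// ln_ge0// ler1n.
have lam_d : 3 * lam <= d%:R.
  rewrite lamE mulrAC ler_piMl ?ler0n// mulr_ile1 ?(ltW kap0) ?(ltW q0)//.
have h1 : (3 * lam) ^+ d / d`!%:R <= kap ^+ d * e1 ^+ d / n%:R.
  rewrite lamE !exprMn qd [leLHS](_ : _ = kap ^+ d * (d%:R ^+ d / d`!%:R) / n%:R); last by ring.
  by rewrite ler_pM2r ?invr_gt0// ler_pM2l ?exprn_gt0// exp_fact_ge.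
have h2 : expR (3 * lam) <= e1 ^+ d by rewrite -expRM_natl mulr1 ler_expR.
have h3 : 2 ^+ d + 1 <= 3 ^+ d :> R.
  by rewrite -!natrX natr1 ler_nat ltn_exp2r.
apply: (@le_trans _ _ (n%:R * (kap ^+ d * e1 ^+ d / n%:R * (e1 ^+ d * 3 ^+ d)))).
  have lam0 : 0 <= 3 * lam by rewrite lamE !mulr_ge0 ?ler0n ?ltW.
  have g1 : 0 <= 2 ^+ d + 1 :> R by rewrite addr_ge0 ?exprn_ge0.
  have g2 : 0 <= expR (3 * lam) * (2 ^+ d + 1) by rewrite mulr_ge0 ?expR_ge0.
  have g3 : 0 <= (3 * lam) ^+ d / d`!%:R by rewrite divr_ge0 ?ler0n ?exprn_ge0.
  rewrite ler_pM2l//; apply: ler_pM => //.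
  by apply: ler_pM; rewrite ?expR_ge0.
rewrite (_ : _ * _ = (kap * e1 ^+ 2 * 3) ^+ d); last first.
  by rewrite expr2 !exprMn; field; rewrite gt_eqF.
have -> : kap * e1 ^+ 2 * 3 = 100^-1 by rewrite kapE; field; rewrite gt_eqF.
by case: (d) d0 => // m _; rewrite exprS ler_piMr ?invr_ge0 ?exprn_ile1 ?invr_ge0// invf_le1// ler1n.
Qed.

(** With N = ln n this is the monotonicity of n^(1 - 1/x) / x for x <= ln n: exp (N/l - N/m) >= 1 +
    (N/m) (m - l) / l >= m / l. *)
Lemma samples_increasing (R : realType) (N l m : R) : 0 < l -> l <= m -> m <= N ->
  expR ((1 - 1 / l) * N) / l <= expR ((1 - 1 / m) * N) / m.
Proof.
move=> l0 lm mN; have m0 : 0 < m by lra.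
rewrite ler_pdivrMr// mulrAC ler_pdivlMr//.
have -> : (1 - 1 / m) * N = (1 - 1 / l) * N + (N / l - N / m).
  by field; rewrite !gt_eqF.
rewrite expRD -mulrA ler_pM2l ?expR_gt0// -ler_pdivrMr//.
apply: le_trans (expR_ge1Dx _).
have -> : N / l - N / m = N / m * ((m - l) / l) by field; rewrite !gt_eqF.
have Nm : 1 <= N / m by rewrite ler_pdivlMr// mul1r.
have ml : 0 <= (m - l) / l by rewrite divr_ge0 ?subr_ge0// ltW.
have -> : m / l = 1 + (m - l) / l by field; rewrite gt_eqF.
by rewrite lerD2l ler_peMl.
Qed.

(** Put r = n^(1/4) >= K. Then d >= 2 gives n^(1 - 1/d) >= r^2, while d <= A ln n <= 4 A r. *)
Lemma samples_large (R : realType) (A K l : R) (n d : nat) :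
  0 < A -> 1 <= K -> K ^+ 4 <= n%:R -> (1 < d)%N -> d%:R <= A * ln (n%:R : R) -> 1 <= l ->
  K / (4 * A) <= expR ((1 - 1 / d%:R) * ln (n%:R : R)) * l ^+ 2 / d%:R.
Proof.
move=> A0 K1 Kn d1 dA l1.
have n1 : 1 <= n%:R :> R by apply: le_trans Kn; rewrite exprn_ege1.
have n0 : 0 < n%:R :> R by lra.
set N := ln n%:R in dA *.
have N0 : 0 <= N by rewrite ln_ge0.
have d2 : 2 <= d%:R :> R by rewrite ler_nat.
pose r := expR (N / 4).
have r4 : r ^+ 4 = n%:R.
  by rewrite /r -expRM_natl mulrCA divff ?mulr1 ?lnK// pnatr_eq0.
have rK : K <= r.
  by rewrite -(@ler_pXn2r _ 4)// ?nnegrE ?r4// ?expR_ge0//; lra.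
have Nr : N <= 4 * r by have := expR_ge1Dx (N / 4); rewrite /r; lra.
have dR : 0 < d%:R :> R by lra.
have dr : d%:R <= A * (4 * r) by apply: le_trans dA _; rewrite ler_pM2l.
have r0 : 0 < r by apply: expR_gt0.
have X1 : r ^+ 2 <= expR ((1 - 1 / d%:R) * N).
  rewrite /r -expRM_natl ler_expR.
  have : 1 / d%:R <= 2^-1 :> R by rewrite div1r lef_pV2 ?posrE.
  by move: N0; nra.
have X2 : r ^+ 2 <= expR ((1 - 1 / d%:R) * N) * l ^+ 2.
  by apply: le_trans X1 _; rewrite ler_peMr ?expR_ge0// exprn_ege1.
rewrite ler_pdivlMr//; apply: le_trans X2.
apply: (@le_trans _ _ (K / (4 * A) * (A * (4 * r)))).
  by rewrite ler_wpM2l// divr_ge0 ?mulr_ge0 ?ltW//; lra.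
rewrite (_ : _ * _ = K * r); last by field; rewrite gt_eqF.
by rewrite expr2 ler_pM2r.
Qed.

Unset Implicit Arguments.

(* A is the constant in L = O(log n); c, c0 delimit the range of eps; cs and C
   are the constants in the Omega for s and in the O for p_max. The floor 1/n in
   pmax is forced by distr_bound_ge; it is inactive as soon as ln (1/eps) <= L. *)
Theorem theorem1 (R : realType) (A : R) (hA : 0 < A) :
  exists (c c0 cs C : R) (n0 : nat) (beta : nat -> R -> R),
    [/\ 0 < c, 0 < c0, 0 < cs, 0 < C &
    forall (n L : nat) (eps : R),
      (n0 <= n)%N -> (0 < L)%N -> L%:R <= A * ln (n%:R : R) ->
      c / n%:R <= eps -> eps <= c0 ->
      let T := 1 / (beta L eps * n%:R) in
      let s := cs * (n%:R `^ (1 - 1 / L%:R) * ln (1 / eps) ^+ 2 / L%:R) in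
      let pmax := C * Num.max (1 / n%:R)
                              (L%:R ^+ 2 / (n%:R * ln (1 / eps) ^+ 2)) in
      1 <= beta L eps /\
      exists Hp Hm : hist_mixture R n,
        [/\ (forall w : mix_space Hp, s <= (mix_size w)%:R)
              /\ (forall w : mix_space Hm, s <= (mix_size w)%:R),
            forall w : mix_space Hp, Big T (mix_distr w),
            forall w : mix_space Hm, far_from_big T eps (mix_distr w),
            (tv_dist (mix_law Hp) (mix_law Hm) <= (1 / 100)%:E)%E &
            (forall (w : mix_space Hp) (i : 'I_n), mix_distr w i <= pmax)
              /\ (forall (w : mix_space Hm) (i : 'I_n), mix_distr w i <= pmax)]].
Proof.
pose B : R := 28 * 100; pose e1 : R := expR 1; pose c : R := 4 * B ^+ 2 + e1.
pose kap : R := (3 * 10 ^+ 2 * e1 ^+ 2)^-1.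
have B0 : 0 < B by rewrite /B; lra.
have B1 : 1 <= B by rewrite /B; lra.
have BB : 28 * 100 <= B by rewrite /B.
(* The value of [B] is forgotten; only its lower bounds are used from here on. *)
move: B B0 B1 BB @c => B B0 B1 BB c.
have e1_ge1 : 1 <= e1 by have := @expR_ge1Dx R 1; rewrite /e1; lra.
have e1_gt0 : 0 < e1 by lra.
have B20 : 0 < 4 * B ^+ 2 by rewrite mulr_gt0 ?exprn_gt0.
have c0 : 0 < c by rewrite /c addr_gt0.
have c1 : 1 <= c by rewrite /c; lra.
have kap0 : 0 < kap by rewrite invr_gt0 !mulr_gt0 ?exprn_gt0.
(* Chosen so that [samples_large] makes the total rate large enough; the final 1 ensures K >= 1. *)
pose K : R := 4 * (A + 1) * ((12 * 64) * B / kap) + 1.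
have KB0 : 0 <= 4 * (A + 1) * ((12 * 64) * B / kap).
  apply: mulr_ge0; first by apply: mulr_ge0; lra.
  by apply: divr_ge0; [apply: mulr_ge0; lra|exact: ltW].
have K1 : 1 <= K by rewrite /K; lra.
exists c, (c^-1 ^+ 2), (kap / (12 * 64)), (12 * 64), (Num.bound (K ^+ 4)), (fun _ _ => B).
split; [by []|by rewrite exprn_gt0 ?invr_gt0|by rewrite divr_gt0|by []|].
move=> n L eps nn0 L0 LA ceps epsc T s pmax; split=> //.
have Kn : K ^+ 4 <= n%:R.
  have := @archi_boundP R (K ^+ 4) ltac:(by rewrite exprn_ge0//; lra).
  by move/ltW/le_trans; apply; rewrite ler_nat.
have n1 : 1 <= n%:R :> R by apply: le_trans Kn; rewrite exprn_ege1.
have nR : 0 < n%:R :> R by lra.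
have n_gt0 : (0 < n)%N by move: nR; rewrite ltr0n.
have eps0 : 0 < eps by apply: lt_le_trans ceps; rewrite divr_gt0.
pose l := ln (1 / eps).
have epsE : expR (- l) = eps.
  by rewrite /l div1r lnV ?posrE// opprK lnK ?posrE.
set N := ln n%:R in LA.
have NE : expR N = n%:R by rewrite lnK ?posrE.
have l1 : 1 <= l.
  rewrite -lerN2 -ler_expR epsE; apply: le_trans epsc _.
  have cV1 : c^-1 <= 1 by rewrite invf_le1.
  apply: (@le_trans _ _ c^-1); first by rewrite expr2 ler_piMl ?invr_ge0// ltW.
  by rewrite expRN lef_pV2 ?posrE// /c -/e1; lra.
(* The summand e of [c] leaves room for floor l + 1 <= ln n. *)
have lN : l <= N - 1.
  rewrite -lerN2 -ler_expR epsE opprB expRD expRN NE; apply: le_trans ceps.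
  by rewrite ler_pM2r ?invr_gt0// /c -/e1; lra.
have l0 : 0 < l by lra.
pose t := Num.truncn l.
have /andP[tl lt] : t%:R <= l < t.+1%:R by rewrite truncn_itv// ltW.
have t1 : (0 < t)%N by rewrite /t truncn_ge_nat ?(ltW l0).
pose d := maxn L t.+1.
have ltd : l < d%:R by apply: lt_le_trans lt _; rewrite ler_nat leq_maxr.
have d0 : 0 < d%:R :> R by lra.
have d_gt1 : (1 < d)%N by rewrite (leq_trans _ (leq_maxr _ _)).
have tN : t.+1%:R <= N by rewrite -natr1; lra.
have N1 : 0 <= N by lra.
have dA : d%:R <= (A + 1) * N.
  rewrite /d; case: leqP => _; first by apply: le_trans tN _; nra.
  by apply: le_trans LA _; nra.
(* This makes exp (- v d) the square root of eps. *)
pose v := l / (2 * d%:R).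
have v0 : 0 < v by rewrite divr_gt0 ?mulr_gt0.
have v1 : v <= 1 by rewrite ler_pdivrMr ?mulr_gt0// mul1r; lra.
have vd : v * d%:R = l / 2 by rewrite /v; field; rewrite gt_eqF.
pose q := expR (- (N / d%:R)).
pose lam := kap * d%:R * q / 3.
have lam0 : 0 < lam by rewrite divr_gt0 ?mulr_gt0 ?expR_gt0.
(* The sample-size expression as a function of the degree: [s] is a multiple of X(L), the total rate
   is governed by X(d). *)
pose X (r : R) := expR ((1 - 1 / r) * N) * l ^+ 2 / r.
have lamX : lam * n%:R * v ^+ 2 = kap / 12 * X d%:R.
  have XE : expR ((1 - 1 / d%:R) * N) = n%:R * q.
    by rewrite -NE /q -expRD; congr expR; field; rewrite gt_eqF.
  by rewrite /X XE /lam /v; field; rewrite gt_eqF.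
have LR : 0 < L%:R :> R by rewrite ltr0n.
have XL : X L%:R <= X d%:R.
  rewrite /d; case: leqP => // Lt.
  have := @samples_increasing R N L%:R t.+1%:R LR _ tN; rewrite ler_nat => /(_ Lt) h.
  by rewrite /X ![_ * l ^+ 2 / _]mulrAC ler_pM2r ?exprn_gt0.
have XK : (12 * 64) * B / kap <= X d%:R.
  have A1 : 0 < A + 1 by lra.
  have := @samples_large R (A + 1) K l n d A1 K1 Kn d_gt1 dA l1.
  apply: le_trans; rewrite ler_pdivlMr ?mulr_gt0//.
  by rewrite mulrC /K; lra.
have sX : s = kap / (12 * 64) * X L%:R.
  by rewrite /s /X /powR gt_eqF.
have E1 : expR (- (l / 2)) ^+ 2 = eps.
  by rewrite -epsE -expRM_natl; congr expR; field.
have E0 : 0 < expR (- (l / 2)) by apply: expR_gt0.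
have Ele : expR (- (l / 2)) <= c^-1.
  by rewrite -(@ler_pXn2r _ 2)// ?nnegrE ?invr_ge0 ?(ltW E0) ?(ltW c0)// E1.
have cV1 : c^-1 <= 1 by rewrite invf_le1.
have [] := @hard_mixtures R n d B v lam s eps BB n_gt0 (ltnW d_gt1) v0 v1 lam0.
- apply: (@pois_tv_small R n d kap lam n_gt0 (ltnW d_gt1) erefl).
  by rewrite /lam mulrC divfK// pnatr_eq0.
- rewrite vd; apply: (@le_trans _ _ (n%:R * eps)).
    move: ceps; rewrite ler_pdivrMr// mulrC; apply: le_trans.
    by rewrite /c; lra.
  rewrite ler_pM2l// -[leLHS]E1 expr2 ler_piMl ?(ltW E0)//; lra.
- rewrite lamX; move: XK; rewrite ler_pdivrMr// => XK; lra.
- rewrite lamX sX; have := ler_wpM2l (ltW kap0) XL; lra.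
(* eps is the square of its root, and one root is at most 1 / c <= 1 / (4 B^2). *)
- rewrite vd -[leLHS]E1 expr2 ler_pM2l//; apply: le_trans Ele _.
  by rewrite lef_pV2 ?posrE// /c; lra.
move=> Hp [Hm [h1 h2 h3 h4 [h5 h6]]].
have pm : 48 / (n%:R * v ^+ 2) <= pmax.
  rewrite /v (_ : 48 / _ = (12 * 16) * (d%:R ^+ 2 / (n%:R * l ^+ 2))); last first.
    by field; rewrite !gt_eqF.
  have nl0 : 0 < n%:R * l ^+ 2 by rewrite mulr_gt0 ?exprn_gt0.
  (* If d = floor l + 1, then d <= 2 l and the bound is of order 1 / n; otherwise d = L. *)
  rewrite /pmax /d; case: leqP => _.
    apply: (@le_trans _ _ ((12 * 64) * (1 / n%:R))); last by rewrite ler_pM2l// le_max lexx.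
    rewrite mulrA ler_pdivrMr//.
    rewrite (_ : (12 * 64) * (1 / n%:R) * _ = (12 * 16) * (2 * l) ^+ 2); last by field; rewrite gt_eqF.
    rewrite ler_pM2l// lerXn2r ?nnegrE//; first lra.
    by rewrite -natr1; lra.
  apply: (@le_trans _ _ ((12 * 64) * (L%:R ^+ 2 / (n%:R * l ^+ 2)))).
    by rewrite ler_wpM2r ?divr_ge0 ?exprn_ge0 ?(ltW nl0)//; lra.
  by rewrite ler_pM2l// le_max lexx orbT.
exists Hp, Hm; rewrite /T div1r; split=> //.
by split=> w i; [apply: le_trans (h5 w i) pm|apply: le_trans (h6 w i) pm].
Qed.
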